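(* Let $k=\bar{\mathbf F}_2$, let $g$ be a positive integer, and let $C_g$ be the hyperelliptic curve of genus $g$ over $k$ defined by the affine equation $Y^2-Y=X^{2g+1}$. Let $\infty\in C_g(k)$ be its unique point at infinity and let $\sigma\in\mathrm{Aut}_k(C_g)$ be the canonical involution $\sigma(X,Y)=(X,Y+1)$. For any point $P\in C_g(k)-\{\infty\}$, the $2$-pointed curve $(C_g,P,\sigma(P))$ is a generalized Lamé curve.
   Context: Let $k$ be an algebraically closed field of characteristic $p\geq 0$, and let $g,n$ be positive integers with $2g+1\leq n$ and $p$ not dividing $(2g+1)n$. A generalized Lamé cover of degree $n$ (and genus $g$) over $k$ is a tamely ramified cover $f:C\to\mathbf P^1_k$ of degree $n$, unramified outside the points $\infty,0,1$ of $\mathbf P^1$, totally ramified above $\infty$ and $0$, and such that there is a unique ramified point in the fiber above $1$, with ramification index $2g+1$. Then $C$ has genus $g$. If $P_\infty$ (resp. $P_0$) denotes the point of $C$ above $\infty$ (resp. $0$), the triple $(C,P_\infty,P_0)$ is called a generalized Lamé curve of order $n$. A generalized Lamé curve is a generalized Lamé curve of order $n$ for some $n$. *)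

(* Defs.v *)
From HB Require Import structures.
From mathcomp Require Import all_boot all_order all_algebra all_field.
From mathcomp Require Import generic_quotient fraction ring zify.

Set Implicit Arguments.
Unset Strict Implicit.
Unset Printing Implicit Defensive.

Import Order.TTheory GRing.Theory Num.Theory.
Local Open Scope ring_scope.

Section Subextension.
Variables (k K : fieldType) (iota : {rmorphism k -> K}).

Definition in_simple_ext (f z : K) : Prop :=
  exists p q : {poly k}, (map_poly iota q).[f] != 0 /\
    z = (map_poly iota p).[f] / (map_poly iota q).[f].

(* [K : k(f)] = n: there is a basis of n elements.  For n to exist with K of
   transcendence degree 1 over k, f must be transcendental over k. *)
Definition ext_degree (f : K) (n : nat) : Prop :=
  exists b : 'I_n -> K,
    (forall z, exists c : 'I_n -> K,
       (forall i, in_simple_ext f (c i)) /\ z = \sum_i c i * b i) /\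
    (forall c : 'I_n -> K, (forall i, in_simple_ext f (c i)) ->
       \sum_i c i * b i = 0 -> forall i, c i = 0).

Definition transcendental (x : K) : Prop :=
  forall p : {poly k}, (map_poly iota p).[x] = 0 -> p = 0.

Definition is_function_field : Prop :=
  exists (x : K) (n : nat), transcendental x /\ ext_degree x n.

End Subextension.

(* A smooth projective connected curve over an algebraically closed field k is
   encoded by its function field, a finite extension of some k(x) with x
   transcendental over k. *)
Record curve (k : closedFieldType) := Curve {
  fun_field :> fieldType;
  cst : {rmorphism k -> fun_field};
  _ : is_function_field cst }.

Arguments cst {k} c.

Section Places.
Variables (k : closedFieldType) (C : curve k).
Implicit Types f h : C.

(* Normalized discrete valuations of the function field, trivial on k.  The
   value at 0, which should be +oo, is set to 0: hence a valuation is
   determined by its values as a function. *)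
Definition discrete_valuation (v : C -> int) : Prop :=
  [/\ v 0 = 0,
      forall f h, f != 0 -> h != 0 -> v (f * h) = v f + v h,
      forall f h, f != 0 -> h != 0 -> f + h != 0 ->
        Num.min (v f) (v h) <= v (f + h),
      forall c : k, c != 0 -> v (cst C c) = 0
    & exists f, v f = 1].

(* The points of the curve; equality of points is extensional equality [=1]
   of the valuations. *)
Record point := Point {
  ord :> C -> int;
  _ : discrete_valuation ord }.

End Places.

Section Covers.
Variables (k : closedFieldType) (C : curve k).

(* k-points of the projective line: None is infinity.  A function f on C,
   seen as a morphism from C to the projective line, pulls the standard
   uniformizer at a back to [pull_unif f a]. *)
Definition pull_unif (f : C) (a : option k) : C :=
  if a is Some c then f - cst C c else f^-1.

(* P lies above a, and the ramification index of f at P is e. *)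
Definition ram (f : C) (a : option k) (P : point C) (e : nat) : Prop :=
  (0 < e)%N /\ P (pull_unif f a) = e%:Z.

(* [pchar k]^'.-nat e: the positive integer e is prime to the characteristic
   of k (no condition in characteristic 0). *)
Definition tame (f : C) : Prop :=
  forall a P e, ram f a P e -> [pchar k]^'.-nat e.

Definition unramified_above (f : C) (a : option k) : Prop :=
  forall P e, ram f a P e -> e = 1%N.

Definition totally_ramified_at (f : C) (n : nat) (a : option k) (P : point C) :=
  ram f a P n /\ forall Q e, ram f a Q e -> Q =1 P.

Definition only_ramified_at (f : C) (a : option k) (P : point C) (m : nat) :=
  [/\ ram f a P m, m != 1%N & forall Q e, ram f a Q e -> e != 1%N -> Q =1 P].

(* Residue fields are all equal to k, so that ramification indices alone
   decide whether f is tame or unramified at a point.  In particular being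
   unramified at some point makes f separable. *)
Definition gen_lame_cover (g n : nat) (f : C) (Poo P0 : point C) : Prop :=
  [/\ ext_degree (cst C) f n,
      tame f,
      forall a, a \notin [:: None; Some 0; Some 1] -> unramified_above f a,
      totally_ramified_at f n None Poo /\ totally_ramified_at f n (Some 0) P0
    & exists P1, only_ramified_at f (Some 1) P1 (2 * g + 1)].

Definition gen_lame_curve_of_order (g n : nat) (Poo P0 : point C) : Prop :=
  [/\ (0 < g)%N, (0 < n)%N, (2 * g + 1 <= n)%N,
      [pchar k]^'.-nat ((2 * g + 1) * n)%N
    & exists f : C, gen_lame_cover g n f Poo P0].

(* The parameter g is the genus of C, by the Riemann-Hurwitz formula. *)
Definition gen_lame_curve (g : nat) (Poo P0 : point C) : Prop :=
  exists n, gen_lame_curve_of_order g n Poo P0.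

End Covers.

(* Image of a point under the automorphism of the curve whose comorphism is s. *)
Section PointImage.
Variables (k : closedFieldType) (C : curve k) (s : {rmorphism C -> C}).
Hypotheses (s_cst : forall c, s (cst C c) = cst C c) (s_inv : involutive s).

Lemma image_valuation (P : point C) : discrete_valuation (fun f => P (s f)).
Proof.
case: P => v [v0 vM vD vc [t vt]]; split => /=.
- by rewrite rmorph0.
- by move=> f h f0 h0; rewrite rmorphM vM ?fmorph_eq0.
- by move=> f h f0 h0 fh0; rewrite rmorphD vD -?rmorphD ?fmorph_eq0.
- by move=> c c0; rewrite s_cst vc.
- by exists (s t); rewrite s_inv.
Qed.

Definition point_image (P : point C) : point C := Point (image_valuation P).

End PointImage.

Section ArtinSchreier.
Variables (F : fieldType) (c : F).

Definition AS_poly : {poly F} := 'X^2 - 'X - c%:P.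

Lemma size_AS_poly : size AS_poly = 3.
Proof.
rewrite /AS_poly -addrA size_polyDl ?size_polyXn //.
apply: (leq_ltn_trans (size_polyD _ _)); rewrite !size_polyN size_polyX.
by rewrite gtn_max /= (leq_ltn_trans (size_polyC_leq1 _)).
Qed.

Lemma monic_AS_poly : AS_poly \is monic.
Proof.
rewrite /AS_poly -addrA monicE lead_coefDl ?lead_coefXn //.
rewrite size_polyXn; apply: (leq_ltn_trans (size_polyD _ _)).
by rewrite !size_polyN size_polyX gtn_max /= (leq_ltn_trans (size_polyC_leq1 _)).
Qed.

Lemma AS_poly_irreducible :
  (forall r, ~~ root AS_poly r) -> monic_irreducible_poly AS_poly.
Proof.
move=> noroot; split; last exact: monic_AS_poly.
by apply: cubic_irreducible; first rewrite size_AS_poly.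
Qed.

Hypothesis AS_irr : monic_irreducible_poly AS_poly.
Notation h := AS_poly.

(* F[Y] / (Y^2 - Y - c) *)
Definition AS_field : fieldType := {poly %/ AS_poly with AS_irr}.

Definition AS_const : {rmorphism F -> AS_field} := qpolyC AS_poly.

Definition AS_root : AS_field := in_qpoly AS_poly 'X.

Let mk_h : mk_monic h = h.
Proof. by rewrite /mk_monic size_AS_poly monic_AS_poly. Qed.

Let in_qpoly_h : in_qpoly h h = 0.
Proof.
by apply/val_inj; rewrite /= mk_h Pdiv.RingMonic.rmodpp // monic_AS_poly.
Qed.

Let in_qpolyC (a : F) : in_qpoly h a%:P = qpolyC h a.
Proof.
apply/val_inj; rewrite /= mk_h Pdiv.CommonRing.rmodp_small // size_AS_poly.
by rewrite (leq_ltn_trans (size_polyC_leq1 _)).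
Qed.

Lemma AS_root_eq : AS_root ^+ 2 - AS_root = AS_const c.
Proof.
apply/eqP; rewrite -subr_eq0 /AS_root /= -in_qpolyC -rmorphXn /= -!rmorphB.
exact/eqP/in_qpoly_h.
Qed.

Let in_qpoly_lin (a b : F) :
  in_qpoly h (a%:P + b%:P * 'X) = AS_const a + AS_const b * AS_root.
Proof. by rewrite in_qpolyD in_qpolyM (in_qpolyC a) (in_qpolyC b). Qed.

Let val_lin (a b : F) :
  (AS_const a + AS_const b * AS_root : {poly F}) = a%:P + b%:P * 'X.
Proof.
rewrite -in_qpoly_lin.
apply: in_qpoly_small; rewrite mk_h size_AS_poly addrC size_MXaddC.
by case: ifP => // _; rewrite !ltnS size_polyC_leq1.
Qed.

Lemma AS_basis (z : AS_field) (a b : F) :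
  z = AS_const a + AS_const b * AS_root <->
  a = (z : {poly F})`_0 /\ b = (z : {poly F})`_1.
Proof.
split=> [->|[-> ->]].
  by rewrite val_lin !coefD !coefMX !coefC /= addr0 add0r.
apply: val_inj; apply: etrans (esym (val_lin _ _)) => /=.
have r2 : (size (z : {poly F}) <= 2)%N.
  apply: (@leq_trans (size (mk_monic h)).-1); last by rewrite mk_h size_AS_poly.
  exact: size_npoly.
apply/polyP=> i; rewrite coefD coefMX !coefC.
case: i => [|[|i]] /=; rewrite ?addr0 ?add0r ?coefC //.
by apply: nth_default; apply: leq_trans r2 _.
Qed.

Section Conjugation.
Hypothesis char2 : 2 \in [pchar F].

(* The automorphism mapping the root Y to Y + 1. *)
Definition AS_conj (z : AS_field) : AS_field :=
  in_qpoly AS_poly ((z : {poly F}) \Po ('X + 1)).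

Let char2_poly : 2 \in [pchar {poly F}].
Proof. exact: (rmorph_pchar polyC). Qed.

Let h_shift : h \Po ('X + 1) = h.
Proof.
rewrite /AS_poly !comp_polyB comp_polyC comp_Xn_poly comp_polyX.
rewrite -(pFrobenius_autE char2_poly) pFrobenius_autD_comm; last exact: commr1.
rewrite pFrobenius_aut1 pFrobenius_autE.
by congr (_ - _); rewrite opprD addrACA subrr addr0.
Qed.

Let conj_in_qpoly p :
  AS_conj (in_qpoly h p) = in_qpoly h (p \Po ('X + 1)).
Proof.
rewrite /AS_conj /=.
rewrite [in RHS](Pdiv.RingMonic.rdivp_eq monic_AS_poly p) comp_polyD comp_polyM.
by rewrite h_shift in_qpolyD in_qpolyM in_qpoly_h mulr0 add0r mk_h.
Qed.

Let in_qpolyK (z : AS_field) : in_qpoly h z = z.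
Proof. by apply/val_inj/in_qpoly_small/size_mk_monic. Qed.

Fact AS_conj_is_zmod_morphism : zmod_morphism AS_conj.
Proof.
move=> y z; rewrite -[y in LHS]in_qpolyK -[z in LHS]in_qpolyK.
by rewrite -rmorphB conj_in_qpoly comp_polyB rmorphB.
Qed.

Fact AS_conj_is_monoid_morphism : monoid_morphism AS_conj.
Proof.
split=> [|y z].
  by rewrite -[1 in LHS](in_qpoly1 h) conj_in_qpoly comp_polyC in_qpoly1.
rewrite -[y in LHS]in_qpolyK -[z in LHS]in_qpolyK.
by rewrite -in_qpolyM conj_in_qpoly comp_polyM in_qpolyM.
Qed.

Lemma AS_conj_const a : AS_conj (AS_const a) = AS_const a.
Proof. by rewrite /AS_const /= -in_qpolyC conj_in_qpoly comp_polyC. Qed.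

Lemma AS_conj_root : AS_conj AS_root = AS_root + 1.
Proof. by rewrite conj_in_qpoly comp_polyX in_qpolyD in_qpoly1. Qed.

Lemma AS_conjK : involutive AS_conj.
Proof.
move=> z; rewrite -[z in LHS]in_qpolyK !conj_in_qpoly -comp_polyA.
rewrite comp_polyD comp_polyX comp_polyC -addrA.
by rewrite (addrr_pchar2 char2_poly) addr0 comp_polyXr in_qpolyK.
Qed.

Definition AS_conj_rmorphism : {rmorphism AS_field -> AS_field} :=
  HB.pack AS_conj
    (GRing.isZmodMorphism.Build _ _ AS_conj AS_conj_is_zmod_morphism)
    (GRing.isMonoidMorphism.Build _ _ AS_conj AS_conj_is_monoid_morphism).

End Conjugation.
End ArtinSchreier.

Lemma fraction_divP (R : idomainType) (r : {fraction R}) :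
  exists a b : R, b != 0 /\ r = FracField.tofrac a / FracField.tofrac b.
Proof.
elim/quotW: r => r; exists \n_r, \d_r; split; first exact: denom_ratioP.
have b0 : FracField.tofrac \d_r != 0 by rewrite tofrac_eq0 denom_ratioP.
apply: (mulIf b0); rewrite divfK //; unlock FracField.tofrac.
rewrite -[LHS]FracField.pi_mul; apply/eqmodP; rewrite /= /FracField.equivf /FracField.mulf.
rewrite !numden_Ratio ?mulr1 ?oner_neq0 ?denom_ratioP //.
by rewrite mulrC.
Qed.

Lemma root_free_aux (F : fieldType) (x y : F) : y != 0 ->
  x * (x - y) = ((x / y) ^+ 2 - x / y) * (y * y).
Proof. by move=> y0; field. Qed.

Section HyperellipticCurve.
Variables (k : closedFieldType) (g : nat).
Notation kX := {fraction {poly k}}.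

Definition hyperell_rhs : kX := FracField.tofrac ('X^(2 * g + 1) : {poly k}).

Lemma hyperell_irreducible : monic_irreducible_poly (AS_poly hyperell_rhs).
Proof.
apply: AS_poly_irreducible => r.
have [a [b [b0 ->]]] := fraction_divP r; apply/negP => /eqP.
rewrite /AS_poly !hornerE => /eqP.
rewrite subr_eq0 /hyperell_rhs => /eqP E.
have B0 : FracField.tofrac b != 0 by rewrite tofrac_eq0.
have {}E : a * (a - b) = 'X^(2 * g + 1) * (b * b).
  apply/eqP; rewrite -tofrac_eq !(tofracM, tofracB) -E.
  by rewrite -root_free_aux.
have nz : 'X^(2 * g + 1) * (b * b) != 0.
  by rewrite !mulf_neq0 // -size_poly_gt0 size_polyXn.
have sR : size ('X^(2 * g + 1) * (b * b) : {poly k}) = (2 * g + 2 * size b)%N.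
  rewrite mulrC size_mulXn ?mulf_neq0 // size_mul //.
  by have := b0; rewrite -size_poly_gt0; lia.
have a0 : a != 0 by apply: contraNneq nz => a0; rewrite -E a0 mul0r.
have ab0 : a - b != 0 by apply: contraNneq nz => ab0; rewrite -E ab0 mulr0.
have := congr1 (fun p : {poly k} => size p) E; rewrite sR size_mul //.
have b1 : (0 < size b)%N by rewrite size_poly_gt0.
case: (ltnP (size b) (size a)) => le_ab.
  by rewrite size_polyDl ?size_polyN // => {}E; move: (size a) (size b) le_ab b1 E => sa sb; lia.
have := size_polyD a (- b); rewrite size_polyN.
move: (size (a - b)) (size a) (size b) b1 le_ab => sab sa sb; lia.
Qed.

(* k(X)[Y] / (Y^2 - Y - X^(2g+1)) *)
Definition hyperell_field : fieldType := AS_field hyperell_irreducible.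

Definition hyperell_kX : {rmorphism kX -> hyperell_field} :=
  AS_const hyperell_irreducible.

Definition hyperell_cst : {rmorphism k -> hyperell_field} :=
  hyperell_kX \o @FracField.tofrac {poly k} \o polyC.

Definition hyperell_X : hyperell_field :=
  hyperell_kX (FracField.tofrac ('X : {poly k})).

Definition hyperell_Y : hyperell_field := AS_root hyperell_irreducible.

Lemma hyperell_eq : hyperell_Y ^+ 2 - hyperell_Y = hyperell_X ^+ (2 * g + 1).
Proof.
apply: etrans (AS_root_eq hyperell_irreducible) _.
rewrite /hyperell_X -(rmorphXn hyperell_kX).
by rewrite -tofracXn.
Qed.

Let cst_horner (p : {poly k}) :
  (map_poly hyperell_cst p).[hyperell_X] = hyperell_kX (FracField.tofrac p).
Proof.
rewrite !map_poly_comp horner_map; congr (hyperell_kX _).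
rewrite horner_map; congr FracField.tofrac.
exact: comp_polyXr.
Qed.

Let simple_extE z : in_simple_ext hyperell_cst hyperell_X z <->
  exists r, z = hyperell_kX r.
Proof.
split=> [[p [q [_ ->]]]|[r ->]].
  exists (FracField.tofrac p / FracField.tofrac q).
  by rewrite !cst_horner fmorph_div.
have [a [b [b0 ->]]] := fraction_divP r; exists a, b.
by rewrite !cst_horner fmorph_div fmorph_eq0 tofrac_eq0.
Qed.

Let basis_sum (d : 'I_2 -> kX) :
  \sum_i hyperell_kX (d i) * hyperell_Y ^+ i =
  hyperell_kX (d ord0) + hyperell_kX (d ord_max) * hyperell_Y.
Proof.
rewrite big_ord_recl big_ord1 expr0 mulr1.
by have -> : lift ord0 ord0 = ord_max :> 'I_2 by apply: val_inj.
Qed.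

Lemma hyperell_function_field : is_function_field hyperell_cst.
Proof.
exists hyperell_X, 2; split.
  by move=> p /eqP; rewrite cst_horner fmorph_eq0 tofrac_eq0 => /eqP.
exists (fun i => hyperell_Y ^+ i); split.
  move=> z; pose r := (z : {poly kX}).
  exists (fun i => hyperell_kX r`_i); split=> [i|].
    by apply/simple_extE; exists r`_i.
  by rewrite basis_sum; apply/AS_basis.
move=> c c_kX.
have /fin_all_exists [d cE] : forall i, exists r, c i = hyperell_kX r.
  by move=> i; apply/simple_extE.
under eq_bigr do rewrite cE.
rewrite basis_sum => /esym/AS_basis [].
rewrite !coef0 => d0 d1 i; rewrite cE.
have [->|->] : i = ord0 \/ i = ord_max.
- by case: i => [[|[|i]] lti] //; [left|right]; apply: val_inj.
- by rewrite d0 rmorph0.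
- by rewrite d1 rmorph0.
Qed.

Definition hyperell_curve : curve k := Curve hyperell_function_field.

Section Involution.
Hypothesis char2 : 2 \in [pchar k].

Let char2_kX : 2 \in [pchar kX].
Proof.
by apply: (rmorph_pchar (@FracField.tofrac _)); apply: (rmorph_pchar polyC).
Qed.

(* The comorphism of (X, Y) |-> (X, Y + 1). *)
Definition hyperell_conj : {rmorphism hyperell_curve -> hyperell_curve} :=
  AS_conj_rmorphism hyperell_irreducible char2_kX.

Lemma hyperell_conjX : hyperell_conj hyperell_X = hyperell_X.
Proof. exact: AS_conj_const. Qed.

Lemma hyperell_conjY : hyperell_conj hyperell_Y = hyperell_Y + 1.
Proof. exact: AS_conj_root. Qed.

Lemma hyperell_conj_cst c :
  hyperell_conj (cst hyperell_curve c) = cst hyperell_curve c.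
Proof. exact: AS_conj_const. Qed.

Lemma hyperell_conjK : involutive hyperell_conj.
Proof. exact: AS_conjK. Qed.

Definition hyperell_involution (P : point hyperell_curve) :
    point hyperell_curve :=
  point_image hyperell_conj_cst hyperell_conjK P.

End Involution.

(* The points outside the affine curve are those where one of the coordinates
   has a pole; there is only one. *)
Definition at_infinity (P : point hyperell_curve) : Prop :=
  P hyperell_X < 0 \/ P hyperell_Y < 0.

End HyperellipticCurve.

Lemma pchar2_of_F2 (k : fieldType) (j : {rmorphism 'F_2 -> k}) :
  2 \in [pchar k].
Proof. exact: (rmorph_pchar j (pchar_Fp (isT : prime 2))). Qed.

(* Main.v *)
From HB Require Import structures.
Require Import Defs.
From mathcomp Require Import all_boot all_order all_algebra all_field.
From mathcomp Require Import ring zify.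
From Stdlib Require Import Classical.

Set Implicit Arguments.
Unset Strict Implicit.
Unset Printing Implicit Defensive.

Import Order.TTheory GRing.Theory Num.Theory.
Local Open Scope ring_scope.

(**
Let [x0] be the abscissa of [P] and [t = X - x0], so that the curve is
[Y^2 - Y = c(t)] with [deg c = 2 g + 1], and [P] and its conjugate are the two
points over [t = 0]. For [beta = A + B Y] with conjugate [beta'], the product
[beta beta'] is the polynomial [A^2 + A B - B^2 c] ([norm_form]).

The coordinates of [P] lie in a finite field, so the divisor class of [P] minus
infinity has finite order; this order is odd because the Jacobian has no point
of order 2. Concretely, there are [A] and [B] with [beta beta' = t^n], [n] odd,
and [B] prime to [t] ([odd_power_norm_exists]). As in the classical treatment of
Pell's equation, the pigeonhole principle yields elements of the form
[A + B Y] with norm [t^M u], [deg u <= g] and [M] arbitrarily large; two of them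
that share [u] and are congruent modulo [u] have a quotient of norm a power of
[t] ([pell_exists]). When the exponent of the norm is even, [(A + t^m)^2] is the
product of [B] and a polynomial prime to [B]; hence [B] is a square, and so is
[A + B Y], whose root has norm [t^m] ([halve_norm]).

The cover is [f = beta / beta'], with divisor [n (sigma P) - n P] after [beta]
and [beta'] have been exchanged if necessary. Every other point is treated with
the identities [f - 1 = B / beta'] and
[(beta - d beta') (beta - d^-1 beta') = B^2 - (d + d^-1) t^n] of characteristic
2. For [d] different from 0 and 1, the derivative of the polynomial
[B^2 - (d + d^-1) t^n] is a nonzero multiple of [t^(n-1)], and the derivative of
the norm equation shows that [A B' = t^(n-1)] at a root of [B]; so all the roots
away from [t = 0] are simple and [f] is unramified at the finite points other
than [P] and [sigma P] ([unramified_away]). At infinity, [n] being odd forces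
[n = 2 deg B + 2 g + 1], and [f - 1] vanishes to order [n - 2 deg B = 2 g + 1]
([val_infinity_f1]).

Points being abstract discrete valuations, these computations rest on a
classification: a valuation is determined by its centre, which is either a
solution of the equation of the curve or infinity ([centre_exists],
[centre_unique], [infinity_unique]). The degree of [f] is obtained from the
basis [1, t, ..., t^(n-1)]: it spans because [(f + f^-1) t^n = B(t)^2], and it is
free because its elements have distinct valuations modulo [n] at [P]
([ext_degree_f]).
*)

(** * Norm forms *)

Definition norm_form (R : nzRingType) (c A B : {poly R}) : {poly R} :=
  A ^+ 2 + A * B - B ^+ 2 * c.

Section NormForm.
Variables (R : comNzRingType) (c : {poly R}).
Implicit Types A B : {poly R}.

Lemma norm_formM A1 B1 A2 B2 :
  norm_form c (A1 * A2 + B1 * B2 * c) (A1 * B2 + B1 * A2 + B1 * B2) =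
  norm_form c A1 B1 * norm_form c A2 B2.
Proof. by rewrite /norm_form; ring. Qed.

Lemma norm_form_conj A B : norm_form c (A + B) (- B) = norm_form c A B.
Proof. by rewrite /norm_form; ring. Qed.

Lemma norm_formZ D A B : norm_form c (D * A) (D * B) = D ^+ 2 * norm_form c A B.
Proof. by rewrite /norm_form; ring. Qed.

End NormForm.

Lemma map_norm_form (R S : comNzRingType) (f : {rmorphism R -> S}) (c A B : {poly R}) :
  map_poly f (norm_form c A B) = norm_form (map_poly f c) (map_poly f A) (map_poly f B).
Proof. by rewrite /norm_form !(rmorphB, rmorphD, rmorphM). Qed.

Section NormSize.
Variables (R : idomainType) (g : nat) (c : {poly R}).
Hypothesis size_c : size c = (2 * g + 2)%N.
Implicit Types A B : {poly R}.

(** [A^2] has even degree and [B^2 c] odd degree, so the leading terms never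
    cancel; the cross term [A B] is dominated by one of them. *)
Lemma size_norm_form A B : B != 0 ->
  size (norm_form c A B) = maxn (2 * size A - 1) (2 * size B + 2 * g).
Proof.
move=> B0.
have c0 : c != 0 by rewrite -size_poly_gt0 size_c addnS.
have sB : (0 < size B)%N by rewrite size_poly_gt0.
have sBc : size (B ^+ 2 * c) = (2 * size B + 2 * g)%N.
  by rewrite size_mul ?expf_neq0 // expr2 size_mul // size_c; lia.
have [->|A0] := eqVneq A 0.
  by rewrite /norm_form mul0r expr0n !add0r size_polyN sBc size_poly0; lia.
have sA : (0 < size A)%N by rewrite size_poly_gt0.
have sA2 : size (A ^+ 2) = (2 * size A - 1)%N by rewrite expr2 size_mul //; lia.
have sAB : size (A * B) = (size A + size B - 1)%N by rewrite size_mul //; lia.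
have [lt|ge] := ltnP (2 * size B + 2 * g) (2 * size A - 1).
  rewrite /norm_form -addrA size_polyDl sA2; first by lia.
  by apply: leq_ltn_trans (size_polyD _ _) _; rewrite size_polyN sAB sBc; lia.
rewrite /norm_form addrC size_polyDl size_polyN sBc; first by lia.
by apply: leq_ltn_trans (size_polyD _ _) _; rewrite sA2 sAB; lia.
Qed.

Lemma size_norm_form0 A : size (norm_form c A 0) = (2 * size A - 1)%N.
Proof.
rewrite /norm_form mulr0 expr0n mul0r subr0 addr0.
have [->|A0] := eqVneq A 0; first by rewrite expr0n /= size_poly0.
by rewrite expr2 size_mul //; lia.
Qed.

Lemma norm_form_eq0 A B : (norm_form c A B == 0) = (A == 0) && (B == 0).
Proof.
have [->|B0] := eqVneq B 0; last first.
  rewrite andbF -size_poly_eq0 size_norm_form //; apply/negbTE.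
  by have := B0; rewrite -size_poly_gt0; lia.
rewrite andbT -!size_poly_eq0 size_norm_form0; lia.
Qed.

Lemma size_norm_form_le m A B :
  (size (norm_form c A B) <= m)%N =
  (2 * size A <= m.+1)%N && ((B == 0) || (2 * size B + 2 * g <= m)%N).
Proof.
have [->|B0] /= := eqVneq B 0; first by
  rewrite size_norm_form0 andbT; move: (size A) => a; lia.
by rewrite size_norm_form //; move: (size A) (size B) => a b; lia.
Qed.

End NormSize.

(** When [A] and [B] have no common root at [a], in characteristic 2 the function
    [A + B Y] cannot vanish at both points above [a], as its values there differ
    by that of [B]. *)
Lemma primitive_pair (F : fieldType) (a : F) (A B : {poly F}) :
  (A != 0) || (B != 0) ->
  exists j A' B', [/\ A = ('X - a%:P) ^+ j * A', B = ('X - a%:P) ^+ j * B' &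
                      ~~ (root A' a && root B' a)].
Proof.
elim: {A B}_.+1 {-2}A {-2}B (ltnSn (size A + size B)) => // m IHm A B lem AB0.
have [/andP[rA rB]|nr] := boolP (root A a && root B a); last first.
  by exists 0%N, A, B; rewrite expr0 !mul1r.
have [/factor_theorem [A1 eA] /factor_theorem [B1 eB]] := (rA, rB).
have t0 : 'X - a%:P != 0 :> {poly F} by rewrite polyXsubC_eq0.
have s1 (p : {poly F}) : size (p * ('X - a%:P)) = if p == 0 then 0%N else (size p).+1.
  have [->|p0] := eqVneq p 0; first by rewrite mul0r size_poly0.
  by rewrite size_Mmonic ?monicXsubC // size_XsubC addn2.
have [||j [A' [B' [eA' eB' nr]]]] := IHm A1 B1.
- move: lem AB0; rewrite eA eB !s1 !mulf_eq0 !(negPf t0) !orbF.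
  by do 2![case: eqP => [->|_] /=]; rewrite ?size_poly0; lia.
- by move: AB0; rewrite eA eB !mulf_eq0 !(negPf t0) !orbF.
exists j.+1, A', B'; split=> //.
  by rewrite eA eA' exprSr mulrAC.
by rewrite eB eB' exprSr mulrAC.
Qed.

(** * Pell's equation over a finite field *)

Lemma char2_eq0 (R : nzRingType) : 2 \in [pchar R] -> 2 = 0 :> R.
Proof. by move=> /andP[_ /eqP]. Qed.

Lemma pchar2_poly (R : comNzRingType) : 2 \in [pchar R] -> 2 \in [pchar {poly R}].
Proof. by move=> c2; apply: (rmorph_pchar (@polyC R)). Qed.

(** Newton's iteration is [y |-> y^2 - c], because the derivative of
    [y^2 - y - c] is [-1]. *)
Lemma hensel_char2 (F : fieldType) (c : {poly F}) (y0 : F) (N : nat) :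
  2 \in [pchar F] -> y0 ^+ 2 - y0 = c.[0] ->
  exists y : {poly F}, 'X^N %| y ^+ 2 - y - c.
Proof.
move=> /pchar2_poly /char2_eq0 c2 y0P; elim: N => [|N [y yP]].
  by exists 0; rewrite expr0 dvd1p.
have [->|N0] := posnP N.
  exists y0%:P; rewrite expr1 -[X in X %| _]subr0 -polyC0 dvdp_XsubCl.
  by rewrite /root !hornerE y0P subrr.
exists (y ^+ 2 - c).
have -> : (y ^+ 2 - c) ^+ 2 - (y ^+ 2 - c) - c =
  (y ^+ 2 - y - c) ^+ 2 + 2 * y * (y ^+ 2 - y - c) by ring.
rewrite c2 !mul0r addr0; apply: dvdp_trans (dvdp_exp2r 2 yP).
by rewrite -exprM dvdp_exp2l // muln2 -addnn -addn1 leq_add2l.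
Qed.

Lemma dvdp_Xn_size (F : fieldType) (p : {poly F}) N :
  ('X^N %| p) = (take_poly N p == 0).
Proof.
apply/idP/eqP => [/dvdpP [q ->]|tp].
  by apply/polyP => i; rewrite coef_take_poly coefMXn coef0; case: ltnP.
by rewrite -[p](poly_take_drop N) tp add0r dvdp_mulIr.
Qed.

(** More coefficients than conditions: the pigeonhole principle replaces
    linear algebra over the finite field. *)
Lemma small_combination (F : finFieldType) (y : {poly F}) (m1 m2 N : nat) :
  (N < m1 + m2)%N ->
  exists A B : {poly F}, [/\ (A != 0) || (B != 0), (size A <= m1)%N,
    (size B <= m2)%N & 'X^N %| A + B * y].
Proof.
move=> ltN.
have szN (ab : {poly_m1 F} * {poly_m2 F}) :
    (size (take_poly N ((ab.1 : {poly F}) + (ab.2 : {poly F}) * y))%R <= N)%N.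
  exact: size_take_poly.
pose phi (ab : {poly_m1 F} * {poly_m2 F}) : {poly_N F} := NPoly (szN ab).
have /injectivePn [[a1 b1] [[a2 b2] nab eab]] : ~~ injectiveb phi.
  apply/negP => /injectiveP inj; have := leq_card _ inj.
  by rewrite card_prod !card_npoly -expnD leq_exp2l ?finNzRing_gt1 // leqNgt ltN.
exists ((a1 : {poly F}) - a2), ((b1 : {poly F}) - b2); split.
- apply: contraNT nab; rewrite negb_or !negbK !subr_eq0 => /andP[/eqP e1 /eqP e2].
  by apply/eqP; congr (_, _); apply: val_inj.
- by rewrite (leq_trans (size_polyD _ _)) // size_polyN geq_max !size_npoly.
- by rewrite (leq_trans (size_polyD _ _)) // size_polyN geq_max !size_npoly.
move/(congr1 val): eab => /= eab; rewrite dvdp_Xn_size.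
have -> : (a1 : {poly F}) - a2 + ((b1 : {poly F}) - b2) * y =
  ((a1 : {poly F}) + (b1 : {poly F}) * y) - ((a2 : {poly F}) + (b2 : {poly F}) * y) by ring.
apply/eqP/polyP => i; move/polyP/(_ i): eab; rewrite !coef_take_poly coefB coef0.
by case: ifP => // _ ->; rewrite subrr.
Qed.

Section Pell.
Variables (F : finFieldType) (g : nat) (c : {poly F}) (y0 : F).
Hypothesis char2 : 2 \in [pchar F].
Hypothesis size_c : size c = (2 * g + 2)%N.
Hypothesis y0P : y0 ^+ 2 - y0 = c.[0].
Notation nrm := (norm_form c).

(** [A + B y], with [y] a power series root of the equation of the curve, can be
    made divisible by [X^(2 d + g + 1)] with [deg A <= d + g] and [deg B <= d].
    The norm then has degree at most [2 d + 2 g + 1], which leaves a cofactor of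
    degree at most [g]. *)
Lemma small_residual_norm (d : nat) : exists A B u M,
  [/\ ~~ root B 0, nrm A B = 'X^M * u, (size u <= g.+1)%N & (d < M)%N].
Proof.
pose N := (2 * d + g + 1)%N.
have [y yP] := hensel_char2 N char2 y0P.
have [|A [B [AB0 sA sB dvd]]] := @small_combination F y (d + g).+1 d.+1 N.
  by rewrite /N; lia.
have [j [A1 [B1 []]]] := primitive_pair 0 AB0; rewrite subr0 => eA eB nr.
have X0 i : 'X^i != 0 :> {poly F} by rewrite -size_poly_gt0 size_polyXn.
have le_j : (j <= d + g)%N.
  have szX (p : {poly F}) : 'X^j * p != 0 -> (j < size ('X^j * p)%R)%N.
    rewrite mulf_eq0 negb_or => /andP[_ p0].
    by rewrite mulrC size_mulXn // -[ltnLHS]addn0 ltn_add2l size_poly_gt0.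
  case/orP: AB0 => [A0|B0].
    by rewrite -ltnS; apply: leq_trans sA; rewrite eA; apply: szX; rewrite -eA.
  have : (j < d.+1)%N by apply: leq_trans sB; rewrite eB; apply: szX; rewrite -eB.
  lia.
have dvd1 : 'X^(N - j) %| A1 + B1 * y.
  rewrite -(dvdp_mul2l _ _ (X0 j)) -exprD subnKC; last by rewrite /N; lia.
  by rewrite mulrDr mulrA -eA -eB.
have lt0 : (0 < N - j)%N by rewrite /N; lia.
have rX (p : {poly F}) : ('X %| p) = root p 0.
  by rewrite -[X in X %| _]subr0 -polyC0 dvdp_XsubCl.
have rB1 : ~~ root B1 0.
  apply: contra nr => rB1; rewrite rB1 andbT -rX.
  have XA : 'X %| A1 + B1 * y.
    by apply: dvdp_trans dvd1; rewrite -[X in X %| _]expr1 dvdp_exp2l.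
  by move: XA; rewrite dvdp_addl // dvdp_mulr // rX.
have /dvdpP [u eu] : 'X^(N - j) %| nrm A1 B1.
  have -> : nrm A1 B1 = (A1 + B1 * y) * (A1 + B1 - B1 * y) + B1 ^+ 2 * (y ^+ 2 - y - c).
    by rewrite /norm_form; ring.
  apply: dvdp_add; [exact: dvdp_mulr | apply: dvdp_mull].
  by apply: dvdp_trans yP; rewrite dvdp_exp2l // leq_subr.
exists A1, B1, u, (N - j)%N; split=> //; [by rewrite mulrC| |by rewrite /N; lia].
have [-> |u0] := eqVneq u 0; first by rewrite size_poly0.
have : (size (nrm A B) <= 2 * d + 2 * g + 2)%N.
  by rewrite (size_norm_form_le size_c); move: (size A) (size B) sA sB => a b; lia.
rewrite eA eB norm_formZ eu -exprM mulrCA -exprD size_mulXn // /N.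
by move: (size u) => su; move: lt0; rewrite /N; lia.
Qed.

(** Otherwise [mu] would be bounded on each class, hence bounded. *)
Lemma unbounded_class (K : finType) (T : Type) (P : T -> Prop) (cl : T -> K)
  (mu : T -> nat) : (forall d, exists2 x, P x & (d < mu x)%N) ->
  exists x1 x2, [/\ P x1, P x2, cl x1 = cl x2 & (mu x1 < mu x2)%N].
Proof.
move=> unb; apply: NNPP => no.
have /fin_all_exists [b bP] : forall i, exists b, forall x, P x -> cl x = i -> (mu x <= b)%N.
  move=> i; case: (classic (exists x, P x /\ cl x = i)) => [[x [Px xi]]|nx].
    exists (mu x) => x' Px' x'i; rewrite leqNgt; apply/negP => lt.
    by apply: no; exists x, x'; rewrite xi.
  by exists 0%N => x Px xi; case: nx; exists x.
have [x Px] := unb (\max_i b i); rewrite ltnNge => /negP []; apply: leq_trans (bP _ x Px erefl) _.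
exact: leq_bigmax.
Qed.

(** The argument for Pell's equation: two elements of equal residual norm [u],
    congruent modulo [u], have a quotient whose norm is a power of [X]. *)
Lemma pell_exists : exists A B L, B != 0 /\ nrm A B = 'X^L.
Proof.
pose P (x : ({poly F} * {poly F}) * ({poly F} * nat)) :=
  let: (A, B, (u, M)) := x in
  [/\ ~~ root B 0, nrm A B = 'X^M * u & (size u <= g.+1)%N].
pose np p : {poly_(g.+1) F} := NPoly (size_take_poly g.+1 p).
have npI (p q : {poly F}) : (size p <= g.+1)%N -> (size q <= g.+1)%N -> np p = np q -> p = q.
  by move=> sp sq /(congr1 val) /=; rewrite !take_poly_id.
pose cl (x : ({poly F} * {poly F}) * ({poly F} * nat)) :=
  let: (A, B, (u, M)) := x in (np u, np (A %% u), np (B %% u)).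
have [d|] := @unbounded_class _ _ P cl (fun x => x.2.2).
  have [A [B [u [M [rB eN su ltM]]]]] := small_residual_norm d.
  by exists (A, B, (u, M)).
move=> [[A1 B1] [u M1]] [[[A2 B2] [u2 M2]]].
rewrite /P /cl => -[[rB1 N1 su] [rB2 N2 su2] e /= ltM].
move: (congr1 (fun x => x.1.1) e) (congr1 (fun x => x.1.2) e) (congr1 snd e) => /= e1 e2 e3 {e}.
have {}e1 : u = u2 by apply: npI.
subst u2.
have nz (A B : {poly F}) : ~~ root B 0 -> nrm A B != 0.
  by move=> rB; rewrite (norm_form_eq0 size_c) negb_and orbC;
    case: eqP rB => // ->; rewrite root0.
have u0 : u != 0 by apply: contraNneq (nz A1 B1 rB1) => u0; rewrite N1 u0 mulr0.
have szm (p : {poly F}) : (size (p %% u)%R <= g.+1)%N.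
  by apply: leq_trans su; rewrite ltnW // ltn_modp.
have dv (p q : {poly F}) : np (p %% u) = np (q %% u) -> u %| p - q.
  by move=> /(npI _ _ (szm _) (szm _)) e; rewrite /dvdp modpD modpN e subrr.
move/dv/dvdpP: e2 => [qA eA]; move/dv/dvdpP: e3 => [qB eB].
have {eA} eA : A1 = A2 + qA * u by rewrite -eA addrC subrK.
have {eB} eB : B1 = B2 + qB * u by rewrite -eB addrC subrK.
pose A := 'X^M2 + qA * (A2 + B2) - qB * B2 * c.
pose B := qB * A2 - qA * B2.
have eAu : u * A = A1 * (A2 + B2) + B1 * (- B2) * c.
  have -> : u * A = 'X^M2 * u + u * (qA * (A2 + B2) - qB * B2 * c) by rewrite /A; ring.
  by rewrite -N2 eA eB /norm_form; ring.
have eBu : u * B = A1 * (- B2) + B1 * (A2 + B2) + B1 * (- B2).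
  by rewrite eA eB /B; ring.
(* [A + B Y] is [X ^ M2] times the quotient of the first element by the second.
   If [B = 0] then [B2^2 X^M1 = B1^2 X^M2], although [B2] is prime to [X]. *)
exists A, B, (M1 + M2)%N; split; last first.
  apply: (mulfI (expf_neq0 2 u0)); rewrite -norm_formZ eAu eBu norm_formM norm_form_conj N1 N2 exprD.
  by ring.
apply: contraNneq rB2 => B0.
have e : B1 * A2 = A1 * B2.
  apply/eqP; rewrite -subr_eq0; apply/eqP.
  by transitivity (u * B); [rewrite eBu; ring | rewrite B0 mulr0].
have : B2 ^+ 2 * nrm A1 B1 = B1 ^+ 2 * nrm A2 B2.
  have -> : B2 ^+ 2 * nrm A1 B1 =
      (A1 * B2) ^+ 2 + (A1 * B2) * B1 * B2 - B1 ^+ 2 * B2 ^+ 2 * c.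
    by rewrite /norm_form; ring.
  by rewrite -e /norm_form; ring.
rewrite N1 N2 -(subnK (ltnW ltM)) exprD => eq.
have X0 : 'X^M1 * u != 0 by rewrite mulf_neq0 // -size_poly_gt0 size_polyXn.
have {}eq : B2 ^+ 2 = B1 ^+ 2 * 'X^(M2 - M1).
  by apply: (mulIf X0); rewrite eq; ring.
have := congr1 (horner^~ 0) eq; rewrite !hornerE expr0n subn_eq0 leqNgt ltM /= mulr0 => /eqP.
by rewrite expf_eq0.
Qed.

End Pell.

(** * The finite field of definition *)

Section FixedField.
Variables (k : closedFieldType) (q : nat).

(** The two hypotheses make this set a finite subfield; they are arguments so that
    the algebraic structures can be attached to it. *)
Definition fixed_by_power of [pchar k].-nat q & (1 < q)%N : {pred k} :=
  fun x => x ^+ q == x.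

Hypotheses (pchar_q : [pchar k].-nat q) (q_gt1 : (1 < q)%N).
Notation fixed := (fixed_by_power pchar_q q_gt1).

Fact fixed_by_power_divring_closed : divring_closed fixed.
Proof.
have fixedE x : (x \in fixed) = (x ^+ q == x) by [].
split=> [|x y|x y]; rewrite !fixedE.
- by rewrite expr1n.
- move=> /eqP ex /eqP ey; apply/eqP/(canRL (addrK y)).
  by rewrite -[X in _ + X]ey -exprDn_pchar // subrK.
- by move=> /eqP ex /eqP ey; rewrite exprMn exprVn ex ey.
Qed.

HB.instance Definition _ :=
  GRing.isDivringClosed.Build k fixed fixed_by_power_divring_closed.

Record fixed_field := FixedField {
  fixed_val : k;
  _ : fixed_val \in fixed }.

HB.instance Definition _ := [isSub for fixed_val].
HB.instance Definition _ := [Choice of fixed_field by <:].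
HB.instance Definition _ := [SubChoice_isSubIntegralDomain of fixed_field by <:].
HB.instance Definition _ := [SubIntegralDomain_isSubField of fixed_field by <:].

Let roots := sval (closed_field_poly_normal ('X^q - 'X : {poly k})).

Let mem_roots (x : fixed_field) : val x \in roots.
Proof.
have X_lt : (size (- 'X : {poly k}) < size ('X^q : {poly k}))%N.
  by rewrite size_polyN size_polyX size_polyXn ltnS.
have : root ('X^q - 'X) (val x).
  by rewrite /root !hornerE subr_eq0; apply: (valP x).
rewrite /roots; case: closed_field_poly_normal => s /= ->.
by rewrite lead_coefDl // lead_coefXn scale1r root_prod_XsubC.
Qed.

Let code (x : fixed_field) : 'I_(size roots) :=
  Ordinal (etrans (index_mem (val x) roots) (mem_roots x)).

Let decode (i : 'I_(size roots)) : option fixed_field :=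
  insub (nth 0 roots i).

Let codeK : pcancel code decode.
Proof. by move=> x; rewrite /decode /= nth_index ?valK. Qed.

HB.instance Definition _ := PCanIsCountable codeK.
HB.instance Definition _ : isFinite fixed_field := PCanIsFinite codeK.

End FixedField.

Lemma expr_pchar_inj (R : idomainType) (n : nat) :
  [pchar R].-nat n -> injective (fun x : R => x ^+ n).
Proof.
move=> nP x y /= e; apply/eqP; rewrite -subr_eq0.
have n0 : (0 < n)%N by case/andP: nP.
have : (x - y) ^+ n + y ^+ n == 0 + y ^+ n by rewrite -exprDn_pchar // subrK add0r e.
by rewrite (inj_eq (addIr _)) expf_eq0 n0.
Qed.

Lemma pchar2_nat (R : nzRingType) r : 2 \in [pchar R] -> [pchar R].-nat (2 ^ r)%N.
Proof. by move=> c2; rewrite pnatX (pnatE _ (isT : prime 2)) c2. Qed.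

(** The conjugates [x ^ (2 ^ i)] are roots of one polynomial over the prime
    field, so two of them coincide. *)
Lemma frobenius_periodic (k : fieldType) (j : {rmorphism 'F_2 -> k}) (x : k) :
  integralOver j x -> exists2 r, (0 < r)%N & x ^+ (2 ^ r) = x.
Proof.
have c2 := pchar2_of_F2 j.
case=> p mon rx.
have rxi i : root (map_poly j p) (x ^+ (2 ^ i)).
  elim: i => [|i]; first by rewrite expr1.
  rewrite expnSr exprM; move: (x ^+ _) => z rz.
  have ej : map_poly (pFrobenius_aut c2) (map_poly j p) = map_poly j p.
    rewrite -map_poly_comp; apply: eq_map_poly => a /=.
    rewrite pFrobenius_autE -rmorphXn; congr (j _).
    by case: a => [[|[|]]] // i2; apply: val_inj.
  by rewrite -ej /root -pFrobenius_autE horner_map fmorph_eq0.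
have q0 : map_poly j p != 0 by rewrite map_poly_eq0 monic_neq0.
pose s := mkseq (fun i => x ^+ (2 ^ i)) (size (map_poly j p)).
have : ~~ uniq s.
  apply/negP => us; suff rs : all (root (map_poly j p)) s.
    by have := max_poly_roots q0 rs us; rewrite size_mkseq ltnn.
  by apply/allP => _ /mapP [i _ ->].
case/(uniqPn 0) => a [b []]; rewrite size_mkseq => ltab ltb.
rewrite !nth_mkseq ?(ltn_trans ltab) // => e.
exists (b - a)%N; first by rewrite subn_gt0.
apply: (expr_pchar_inj (pchar2_nat a c2)).
by rewrite /= -exprM -expnD subnK // ltnW.
Qed.

Lemma frobenius_periodicM (k : fieldType) (x : k) (r m : nat) :
  x ^+ (2 ^ r) = x -> x ^+ (2 ^ (r * m)) = x.
Proof.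
move=> e; elim: m => [|m IHm]; first by rewrite muln0 expr1.
by rewrite mulnS expnD exprM e.
Qed.

(** * Descent to an odd exponent *)

Section Square.
Variables (k : closedFieldType).
Hypothesis char2 : 2 \in [pchar k].

Lemma coprimep_closed (p q : {poly k}) :
  (forall x, root p x -> ~~ root q x) -> coprimep p q.
Proof.
move=> h; rewrite /coprimep; apply/negPn/negP => /closed_rootP [x].
by rewrite root_gcd => /andP [/h /negbTE ->].
Qed.

Lemma deriv0_square (p : {poly k}) : p^`() = 0 -> exists q, p = q ^+ 2.
Proof.
move=> p'0.
have sq (a : k) : exists b, b ^+ 2 == a.
  have [|b] := closed_rootP ('X^2 - a%:P : {poly k}) _.
    by rewrite size_polyDl size_polyXn // size_polyN (leq_ltn_trans (size_polyC_leq1 _)).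
  by rewrite /root !hornerE subr_eq0; exists b.
have oddp i : odd i -> p`_i = 0.
  case: i => // i /= oi; have := coef_deriv p i; rewrite p'0 coef0 -mulr_natr.
  have -> : (i.+1)%:R = 1 :> k.
    by rewrite -natr1 -(odd_double_half i) (negPf oi) add0n -mul2n natrM (char2_eq0 char2) mul0r add0r.
  by rewrite mulr1.
pose s i := xchoose (sq p`_i.*2).
pose q := \poly_(i < size p) s i.
exists q.
have c2 := pchar2_poly char2.
have -> : q ^+ 2 = \sum_(i < size p) (p`_i.*2 *: 'X^(i.*2)).
  rewrite -(pFrobenius_autE c2) /q poly_def rmorph_sum; apply: eq_bigr => i _.
  by rewrite [LHS]pFrobenius_autE exprZn -exprM muln2 (eqP (xchooseP (sq _))).
apply/polyP => i; rewrite coef_sum.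
under eq_bigr do rewrite coefZ coefXn.
have [oi|ei] := boolP (odd i).
  rewrite oddp // big1 // => m _; case: eqP => [e|]; last by rewrite mulr0.
  by move: oi; rewrite e odd_double.
have eh : i = i./2.*2 by rewrite -[LHS](odd_double_half i) (negPf ei).
have [lt|ge] := ltnP i./2 (size p).
  rewrite (bigD1 (Ordinal lt)) //= -eh eqxx mulr1 big1 ?addr0 // => m nm.
  rewrite [X in X == _]eh (inj_eq double_inj) (_ : (_ == _) = false) ?mulr0 //.
  by apply/negbTE; apply: contra nm => /eqP e; apply/eqP/val_inj.
rewrite big1 => [|m _].
  by rewrite nth_default // (leq_trans ge) // [leqRHS]eh -addnn leq_addr.
rewrite [X in X == _]eh (inj_eq double_inj) (_ : (_ == _) = false) ?mulr0 //.
by apply/negbTE/eqP => e; have := ltn_ord m; rewrite -e ltnNge ge.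
Qed.

(** The derivative [p' q + p q'] of a square vanishes, so [p] divides [p'], and
    [p' = 0]. *)
Lemma coprime_factor_square (p q r : {poly k}) :
  coprimep p q -> p * q = r ^+ 2 -> exists s, p = s ^+ 2.
Proof.
move=> cop e; apply: deriv0_square; apply/eqP; apply: contraT => p'0.
have p0 : p != 0 by apply: contraNneq p'0 => ->; rewrite deriv0.
have : (p * q)^`() = 0.
  by rewrite e expr2 derivM mulrC -mulr2n -mulr_natr (char2_eq0 (pchar2_poly char2)) mulr0.
rewrite derivM => /eqP; rewrite addr_eq0 => /eqP e'.
have : p %| p^`() * q by rewrite e' dvdpNr dvdp_mulIl.
rewrite Gauss_dvdpl // => /(dvdp_leq p'0); rewrite leqNgt.
by rewrite lt_size_deriv.
Qed.

End Square.

Section Descent.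
Variables (k : closedFieldType) (g : nat) (c : {poly k}).
Hypothesis char2 : 2 \in [pchar k].
Hypothesis size_c : size c = (2 * g + 2)%N.
Notation nrm := (norm_form c).

Let X0 n : 'X^n != 0 :> {poly k}.
Proof. by rewrite -size_poly_gt0 size_polyXn. Qed.

(** [A + B Y] is the square of [A1 + B1 Y]: by the norm equation [(A + X^m)^2] is
    the product of the coprime polynomials [B] and [A - B c], so [B] is a square
    [B1^2], and [B1] divides [A + X^m]. *)
Lemma halve_norm A B m : ~~ root B 0 -> nrm A B = 'X^(2 * m) -> (0 < m)%N ->
  exists A1 B1, ~~ root B1 0 /\ nrm A1 B1 = 'X^m.
Proof.
move=> rB e m0.
have two0 := char2_eq0 (pchar2_poly char2).
have e1 : (A + 'X^m) ^+ 2 = B * (A - B * c).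
  have -> : (A + 'X^m) ^+ 2 = A ^+ 2 + 'X^(2 * m) + 2 * A * 'X^m.
    by rewrite mulnC exprM; ring.
  rewrite -e /norm_form two0 !mul0r addr0.
  have -> : A ^+ 2 + (A ^+ 2 + A * B - B ^+ 2 * c) = 2 * A ^+ 2 + B * (A - B * c) by ring.
  by rewrite two0 mul0r add0r.
have B0 : B != 0 by apply: contraNneq rB => ->; rewrite root0.
have [||R eR] := @coprime_factor_square _ char2 B (A - B * c) (A + 'X^m).
- apply: coprimep_closed => x rx; apply/negP; rewrite /root !hornerE (rootP rx) mul0r subr0.
  move/eqP => Ax; have := congr1 (horner^~ x) e.
  rewrite /norm_form !hornerE Ax (rootP rx) !expr0n /= !mul0r subr0 addr0 => /esym/eqP.
  by rewrite expf_eq0 => /andP[_ /eqP x0]; move: rB; rewrite -x0 rx.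
- by rewrite e1.
have rR : ~~ root R 0.
  by apply: contra rB; rewrite eR /root hornerE expf_eq0 => /eqP ->; rewrite eqxx.
have R0 : R != 0 by apply: contraNneq rR => ->; rewrite root0.
have /dvdpP [A1 eA1] : R %| A + 'X^m.
  by rewrite -(dvdp_pexp2r _ _ (isT : 0 < 2)%N) e1 -eR dvdp_mulIl.
exists A1, R; split=> //.
have eA2 : A1 ^+ 2 = A - B * c.
  by apply: (mulIf B0); rewrite [RHS]mulrC -e1 eA1 eR; ring.
rewrite /norm_form eA2 -eA1 -eR.
have -> : A - B * c + (A + 'X^m) - B * c = 'X^m + 2 * (A - B * c) by ring.
by rewrite two0 mul0r addr0.
Qed.

(** Infinite descent on the exponent: factors [X] are removed from [B], then the
    exponent is halved as long as it is even. *)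
Lemma odd_power_norm A B L : B != 0 -> nrm A B = 'X^L ->
  exists A1 B1 n, [/\ ~~ root B1 0, nrm A1 B1 = 'X^n & odd n].
Proof.
elim/ltn_ind: L A B => L IH A B B0 e.
have L0 : (0 < L)%N.
  rewrite lt0n; apply: contraTneq isT => L0.
  have := size_norm_form size_c A B0; rewrite e L0 size_polyXn.
  by move: B0; rewrite -size_poly_gt0; move: (size A) (size B) => a b; lia.
have [rB|rB] := boolP (root B 0).
  have rA : root A 0.
    have := congr1 (horner^~ 0) e; rewrite /norm_form !hornerE (rootP rB) !expr0n.
    by rewrite !mul0r mulr0 subr0 addr0 (gtn_eqF L0) /= => /eqP; rewrite expf_eq0.
  have fact (p : {poly k}) : root p 0 -> exists p1, p = 'X * p1.
    by case/factor_theorem => p1 ->; exists p1; rewrite polyC0 subr0 mulrC.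
  have [[A1 eA] [B1 eB]] := (fact _ rA, fact _ rB).
  move: B0 e; rewrite eA eB norm_formZ mulf_eq0 negb_or => /andP[_ B10] e.
  have L2 : (1 < L)%N.
    rewrite ltn_neqAle L0 andbT; apply/eqP => L1; move: e; rewrite -L1 expr2 -mulrA expr1.
    move/(congr1 (fun p => p %/ 'X)).
    rewrite mulrC mulpK ?polyX_eq0 // divpp ?polyX_eq0 // => /(congr1 (horner^~ 0)).
    by rewrite !hornerE => /esym/eqP; rewrite oner_eq0.
  apply: (IH (L - 2)%N _ A1 B1 B10); first by rewrite ltn_subrL L0.
  apply: (mulfI (X0 2)); rewrite e -exprD subnKC //.
have [oL|eL] := boolP (odd L); first by exists A, B, L.
have eh : L = (2 * L./2)%N by rewrite mul2n -[LHS](odd_double_half L) (negPf eL).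
have h0 : (0 < L./2)%N by move: L0; rewrite {1}eh muln_gt0.
have [|A1 [B1 [rB1 e1]]] := @halve_norm A B L./2 rB _ h0; first by rewrite -eh.
apply: (IH L./2 _ A1 B1) e1; last by apply: contraNneq rB1 => ->; rewrite root0.
by rewrite [ltnRHS]eh mul2n -addnn -[ltnLHS]addn0 ltn_add2l.
Qed.

(** The term [B^2 c] is the one of odd degree. *)
Lemma odd_norm_degree A B n : B != 0 -> nrm A B = 'X^n -> odd n ->
  n = (2 * size B + 2 * g - 1)%N.
Proof.
move=> B0 e on; have := size_norm_form size_c A B0; rewrite e size_polyXn.
by move: B0; rewrite -size_poly_gt0; move: (size A) (size B) => a b; lia.
Qed.

End Descent.

Lemma map_XaddC_exp (R S : nzRingType) (f : {rmorphism R -> S}) (a : R) m :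
  map_poly f (('X + a%:P) ^+ m) = ('X + (f a)%:P) ^+ m.
Proof. by rewrite rmorphXn rmorphD /= map_polyX map_polyC. Qed.

(** The norm equation has a solution over a finite field that contains [x0] and
    the ordinate of a point above it, which the descent makes odd. *)
Lemma odd_power_norm_exists (k : closedFieldType) (j : {rmorphism 'F_2 -> k})
    (g : nat) (x0 : k) : integralRange j ->
  exists A B n,
    [/\ ~~ root B 0, norm_form (('X + x0%:P) ^+ (2 * g + 1)) A B = 'X^n & odd n].
Proof.
move=> k_alg; have c2 := pchar2_of_F2 j.
have [|y0] := closed_rootP ('X^2 - 'X - (x0 ^+ (2 * g + 1))%:P : {poly k}) _.
  by rewrite (size_AS_poly (x0 ^+ (2 * g + 1))).
rewrite /root !hornerE subr_eq0 => /eqP y0P.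
have [r1 r1_gt0 x0r] := frobenius_periodic (k_alg x0).
have [r2 r2_gt0 y0r] := frobenius_periodic (k_alg y0).
pose q := (2 ^ (r1 * r2))%N.
have qP : [pchar k].-nat q := pchar2_nat _ c2.
have q_gt1 : (1 < q)%N by rewrite -(expn0 2) ltn_exp2l // muln_gt0 r1_gt0.
pose F : finFieldType := fixed_field qP q_gt1.
pose io : {rmorphism F -> k} := val.
have lift x : x ^+ q = x -> exists z : F, io z = x.
  by move=> /eqP xq; exists (FixedField (xq : x \in fixed_by_power qP q_gt1)).
have [|a ea] := lift x0; first exact: frobenius_periodicM.
have [|b eb] := lift y0; first by rewrite /q mulnC; apply: frobenius_periodicM.
pose cF : {poly F} := ('X + a%:P) ^+ (2 * g + 1).
have szc (R : fieldType) (z : R) : size (('X + z%:P) ^+ (2 * g + 1)) = (2 * g + 2)%N.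
  by rewrite -[z]opprK polyCN size_exp_XsubC addn2 addn1.
have cF2 : 2 \in [pchar F] by rewrite -(fmorph_pchar io).
have bP : b ^+ 2 - b = cF.[0].
  apply: (fmorph_inj io).
  by rewrite /cF horner_exp hornerD hornerX hornerC add0r rmorphB !rmorphXn eb y0P ea.
have [A [B [L [B0 e]]]] := pell_exists cF2 (szc F a) bP.
apply: (@odd_power_norm k g _ c2 (szc k x0) (map_poly io A) (map_poly io B) L).
  by rewrite map_poly_eq0.
have -> : ('X + x0%:P) ^+ (2 * g + 1) = map_poly io cF by rewrite map_XaddC_exp ea.
by rewrite -map_norm_form e map_polyXn.
Qed.

(** * Simple extensions and spans of powers *)

Section SimpleExtension.
Variables (k K : fieldType) (iota : {rmorphism k -> K}) (f : K).
Notation kf := (in_simple_ext iota f).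

Lemma simple_horner (p : {poly k}) : kf (map_poly iota p).[f].
Proof. by exists p, 1; rewrite rmorph1 hornerC divr1 oner_neq0. Qed.

Lemma simple_cst a : kf (iota a).
Proof. by have := simple_horner a%:P; rewrite map_polyC hornerC. Qed.

Lemma simple_gen : kf f.
Proof. by have := simple_horner 'X; rewrite map_polyX hornerX. Qed.

Lemma simpleD y z : kf y -> kf z -> kf (y + z).
Proof.
move=> [p [q [q0 ->]]] [p' [q' [q'0 ->]]]; exists (p * q' + p' * q), (q * q').
by rewrite !(rmorphD, rmorphM) !(hornerD, hornerM) mulf_neq0 //; split=> //; field; rewrite q0 q'0.
Qed.

Lemma simpleM y z : kf y -> kf z -> kf (y * z).
Proof.
move=> [p [q [q0 ->]]] [p' [q' [q'0 ->]]]; exists (p * p'), (q * q').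
by rewrite !rmorphM !hornerM mulf_neq0 //; split=> //; field; rewrite q0 q'0.
Qed.

Lemma simpleV y : kf y -> kf y^-1.
Proof.
move=> [p [q [q0 ->]]]; have [->|p0] := eqVneq (map_poly iota p).[f] 0.
  by rewrite mul0r invr0 -(rmorph0 iota); apply: simple_cst.
by exists q, p; rewrite p0 invfM invrK mulrC.
Qed.

Lemma simpleB y z : kf y -> kf z -> kf (y - z).
Proof.
move=> ky kz; apply: simpleD => //; rewrite -mulN1r -(rmorph1 iota) -rmorphN.
by apply: simpleM => //; apply: simple_cst.
Qed.

Variables (x : K) (n : nat).

Definition power_span (z : K) := exists d : 'I_n -> K,
  (forall i, kf (d i)) /\ z = \sum_i d i * x ^+ i.

Lemma spanD y z : power_span y -> power_span z -> power_span (y + z).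
Proof.
move=> [d [kd ->]] [e [ke ->]]; exists (fun i => d i + e i); split=> [i|].
  exact: simpleD.
by rewrite -big_split; apply: eq_bigr => i _; rewrite mulrDl.
Qed.

Lemma spanZ a z : kf a -> power_span z -> power_span (a * z).
Proof.
move=> ka [d [kd ->]]; exists (fun i => a * d i); split=> [i|].
  exact: simpleM.
by rewrite mulr_sumr; apply: eq_bigr => i _; rewrite mulrA.
Qed.

Lemma span_lt i : (i < n)%N -> power_span (x ^+ i).
Proof.
move=> lti; exists (fun j => iota (j == i :> nat)%:R); split=> [j|].
  exact: simple_cst.
rewrite (bigD1 (Ordinal lti)) //= eqxx rmorph1 mul1r big1 ?addr0 // => j.
by rewrite -val_eqE /= => /negPf ->; rewrite rmorph0 mul0r.
Qed.

Lemma span_sum (I : Type) (r : seq I) (P : pred I) (F : I -> K) : (0 < n)%N ->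
  (forall i, power_span (F i)) -> power_span (\sum_(i <- r | P i) F i).
Proof.
move=> n0 sF; elim/big_ind: _ => // [|]; last exact: spanD.
rewrite -(mul0r (x ^+ 0)); apply: spanZ; last exact: span_lt.
by rewrite -(rmorph0 iota); apply: simple_cst.
Qed.

Hypotheses (n_gt0 : (0 < n)%N) (span_n : power_span (x ^+ n)).

Lemma span_mulX z : power_span z -> power_span (x * z).
Proof.
move=> [d [kd ->]]; rewrite mulr_sumr; apply: span_sum => // i.
rewrite mulrCA -exprS; apply: spanZ => //.
by have := ltn_ord i; rewrite leq_eqVlt => /orP[/eqP ->|/span_lt].
Qed.

(** Once [x ^ n] lies in the span, the span is a ring. *)
Lemma spanM y z : power_span y -> power_span z -> power_span (y * z).
Proof.
move=> [d [kd ->]] sz; rewrite mulr_suml; apply: span_sum => // i.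
rewrite -mulrA; apply: spanZ => //.
by elim: (i : nat) => [|m IHm]; [rewrite mul1r | rewrite exprS -mulrA; apply: span_mulX].
Qed.

Lemma span_simple a : kf a -> power_span a.
Proof. by move=> ka; rewrite -[a]mulr1; apply: spanZ => //; apply: (span_lt n_gt0). Qed.

Lemma span_horner (p : {poly k}) : power_span (map_poly iota p).[x].
Proof.
elim/poly_ind: p => [|p a IHp]; first by
  rewrite rmorph0 horner0 -(rmorph0 iota); apply/span_simple/simple_cst.
rewrite rmorphD rmorphM /= map_polyX map_polyC hornerD hornerMX hornerC.
apply: spanD; first by rewrite mulrC; apply: span_mulX.
exact/span_simple/simple_cst.
Qed.

End SimpleExtension.

(** * Discrete valuations *)

Lemma int_factor1 (m t : int) : 0 < t -> m * t = 1 -> t = 1.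
Proof.
move=> t0 e; have m0 : 0 < m by rewrite -(pmulr_lgt0 _ t0) e.
have : t <= m * t by rewrite ler_peMl ?(ltW t0).
by rewrite e; lia.
Qed.

Section Valuation.
Variables (k : closedFieldType) (C : curve k) (v : point C).
Implicit Types (f h : C) (a : k).

Lemma cst_neq0 a : a != 0 -> cst C a != 0.
Proof. by rewrite fmorph_eq0. Qed.

Lemma val0 : v 0 = 0.
Proof. by case: v => w []. Qed.

Lemma valM f h : f != 0 -> h != 0 -> v (f * h) = v f + v h.
Proof. by case: v => w [? wM *]; apply: wM. Qed.

Lemma val_min m f h : f != 0 -> h != 0 -> f + h != 0 ->
  m <= v f -> m <= v h -> m <= v (f + h).
Proof.
move=> f0 h0 fh0 mf mh; have := le_trans _ (_ : Num.min (v f) (v h) <= v (f + h)); apply.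
  by rewrite le_min mf.
by case: v => w [? ? wD *]; apply: wD.
Qed.

Lemma val_cst a : v (cst C a) = 0.
Proof.
have [->|a0] := eqVneq a 0; first by rewrite rmorph0 val0.
by case: v => w [? ? ? wc *]; apply: wc.
Qed.

Lemma val1 : v 1 = 0.
Proof. by rewrite -(rmorph1 (cst C)) val_cst. Qed.

Lemma val_uniformizer : exists2 f, f != 0 & v f = 1.
Proof.
have [f vf] : exists f, v f = 1 by case: v => w [].
by exists f => //; apply: contra_eqN vf => /eqP ->; rewrite val0.
Qed.

Lemma valX f n : f != 0 -> v (f ^+ n) = v f *+ n.
Proof.
move=> f0; elim: n => [|n IHn]; first by rewrite expr0 val1.
by rewrite exprS valM ?expf_neq0 // IHn mulrS.
Qed.

Lemma valV f : v f^-1 = - v f.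
Proof.
have [->|f0] := eqVneq f 0; first by rewrite invr0 val0.
by apply/eqP; rewrite -addr_eq0 -valM ?invr_neq0 // mulVf // val1.
Qed.

Lemma valN f : v (- f) = v f.
Proof.
have [->|f0] := eqVneq f 0; first by rewrite oppr0.
by rewrite -mulN1r valM ?oppr_eq0 ?oner_neq0 // -(rmorph1 (cst C)) -rmorphN val_cst add0r.
Qed.

Lemma val_div f h : f != 0 -> h != 0 -> v (f / h) = v f - v h.
Proof. by move=> f0 h0; rewrite valM ?invr_neq0 // valV. Qed.

Lemma regularD f h : 0 <= v f -> 0 <= v h -> 0 <= v (f + h).
Proof.
have [->|f0] := eqVneq f 0; first by rewrite add0r.
have [->|h0] := eqVneq h 0; first by rewrite addr0.
have [->|fh0] := eqVneq (f + h) 0; first by rewrite val0.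
exact: val_min.
Qed.

Lemma regularM f h : 0 <= v f -> 0 <= v h -> 0 <= v (f * h).
Proof.
have [->|f0] := eqVneq f 0; first by rewrite mul0r.
have [->|h0] := eqVneq h 0; first by rewrite mulr0.
by move=> ? ?; rewrite valM ?addr_ge0.
Qed.

(** The value at [0] stands for infinity. *)
Definition above (m : int) f := (f == 0) || (m < v f).

Notation vanishes := (above 0).

Lemma vanishes_regular f : vanishes f -> 0 <= v f.
Proof. by case/orP => [/eqP ->|/ltW //]; rewrite val0. Qed.

Lemma aboveD m f h : above m f -> above m h -> above m (f + h).
Proof.
rewrite /above; have [->|f0] := eqVneq f 0; first by rewrite add0r.
have [->|h0] := eqVneq h 0; first by rewrite addr0 (negPf f0).
have [//|fh0] /= := eqVneq (f + h) 0.
by rewrite -!lezD1; apply: val_min.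
Qed.

Lemma vanishesMr f h : 0 <= v f -> vanishes h -> vanishes (f * h).
Proof.
rewrite /above; have [->|h0] /= := eqVneq h 0; first by rewrite mulr0 eqxx.
have [->|f0] := eqVneq f 0; first by rewrite mul0r eqxx.
by move=> ? ?; rewrite valM // ltr_wpDl ?orbT.
Qed.

Lemma vanishesN f : vanishes (- f) = vanishes f.
Proof. by rewrite /above oppr_eq0 valN. Qed.

(** The smallest of two distinct values is the value of the sum. *)
Lemma val_addl_small f h : f != 0 -> vanishes (h / f) -> f + h != 0 /\ v (f + h) = v f.
Proof.
move=> f0 hf; have -> : f + h = f * (1 + h / f) by field.
have [u0 vu] : 1 + h / f != 0 /\ v (1 + h / f) = 0.
  move: (h / f) hf => {h} h; rewrite /above.
  have [->|h0] /= := eqVneq h 0; first by rewrite addr0 oner_neq0 val1.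
  move=> vh; have u0 : 1 + h != 0.
    apply: contraTneq vh => /eqP; rewrite addrC addr_eq0 => /eqP ->.
    by rewrite valN val1.
  split=> //; apply/eqP; rewrite eq_le [X in _ && X]regularD ?val1 ?(ltW vh) // andbT.
  rewrite leNgt; apply/negP => vu.
  have : 1 <= v (1 + h + - h).
    by apply: val_min; rewrite ?oppr_eq0 ?addrK ?oner_neq0 ?valN.
  by rewrite addrK val1.
by rewrite mulf_neq0 // valM // vu addr0.
Qed.

Lemma val_addl_lt f h : f != 0 -> h != 0 -> v f < v h -> f + h != 0 /\ v (f + h) = v f.
Proof.
by move=> f0 h0 lt; apply: val_addl_small => //; rewrite /above val_div // subr_gt0 lt orbT.
Qed.

Lemma val_unitD a f : a != 0 -> vanishes f ->
  cst C a + f != 0 /\ v (cst C a + f) = 0.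
Proof.
move=> a0 vf; have ca0 := cst_neq0 a0.
have [|? ->] := @val_addl_small (cst C a) f ca0; last by rewrite val_cst.
by rewrite mulrC; apply: vanishesMr; rewrite // valV val_cst.
Qed.

Lemma vanishes_cst a : vanishes (cst C a) = (a == 0).
Proof. by rewrite /above val_cst ltxx orbF fmorph_eq0. Qed.

Lemma pole_horner h (p : {poly k}) : v h < 0 -> p != 0 ->
  (map_poly (cst C) p).[h] != 0 /\ v (map_poly (cst C) p).[h] = v h *+ (size p).-1.
Proof.
move=> vh; have h0 : h != 0 by apply: contraTneq vh => ->; rewrite val0.
elim/poly_ind: p => [|p a IHp]; first by rewrite eqxx.
rewrite rmorphD rmorphM /= map_polyX map_polyC hornerD hornerMX hornerC /=.
have [->|p0] := eqVneq p 0.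
  rewrite rmorph0 horner0 !mul0r !add0r val_cst size_polyC polyC_eq0 => a0.
  by rewrite cst_neq0 // a0.
move=> _; rewrite size_MXaddC (negPf p0) /=; have [z0 vz] := IHp p0.
have vzh : v ((map_poly (cst C) p).[h] * h) = v h *+ size p.
  by rewrite valM // vz -mulrSr prednK // size_poly_gt0.
have [->|a0] := eqVneq a 0; first by rewrite rmorph0 addr0 mulf_neq0.
rewrite -vzh; apply: val_addl_lt; rewrite ?mulf_neq0 ?cst_neq0 //.
by rewrite vzh val_cst pmulrn_llt0 ?size_poly_gt0.
Qed.

(** The term of least value cannot be cancelled by the others. *)
Lemma distinct_val_sum m (F : 'I_m -> C) :
  (forall i j, F i != 0 -> F j != 0 -> v (F i) = v (F j) -> i = j) ->
  \sum_i F i = 0 -> forall i, F i = 0.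
Proof.
move=> dist sum0 i1; apply/eqP; apply: contraT => Fi1.
case: (@Order.TotalTheory.arg_minP _ _ _ i1 (fun i => F i != 0) (fun i => v (F i)) Fi1) => i Fi min.
have : above (v (F i)) (\sum_(j | j != i) F j).
  elim/big_ind: _ => [||j ji]; [by rewrite /above eqxx | exact: aboveD |].
  have [->|Fj] := eqVneq (F j) 0; first by rewrite /above eqxx.
  rewrite /above lt_neqAle min // andbT; apply/orP; right.
  by apply: contra ji => /eqP e; apply/eqP/esym/dist.
move: sum0; rewrite (bigD1 i) //= => /eqP; rewrite addrC addr_eq0 => /eqP ->.
by rewrite /above oppr_eq0 (negPf Fi) valN ltxx.
Qed.

Lemma val_simple h z : v h < 0 -> in_simple_ext (cst C) h z -> z != 0 ->
  exists m : int, v z = m * v h.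
Proof.
move=> vh [p [q [q0 ->]]] z0.
have p0 : p != 0 by apply: contraNneq z0 => ->; rewrite rmorph0 horner0 mul0r.
have q0' : q != 0 by apply: contraNneq q0 => ->; rewrite rmorph0 horner0.
have [hp0 vp] := pole_horner vh p0; have [hq0 vq] := pole_horner vh q0'.
exists ((size p).-1%:Z - (size q).-1%:Z).
by rewrite val_div // vp vq mulrBl -![v h *+ _]mulr_natl !natz.
Qed.

End Valuation.

Notation vanishes v := (above v 0).


Lemma pchar2'_nat (R : nzRingType) e :
  2 \in [pchar R] -> [pchar R]^'.-nat e = odd e.
Proof. by move=> c2; rewrite (eq_pnat _ (eq_negn (pcharf_eq c2))) odd_2'nat. Qed.

(** * Points of an Artin-Schreier curve *)

Section ArtinSchreierCurve.
Variables (k : closedFieldType) (C : curve k) (g : nat) (c : {poly k}).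
(* The function field is abstracted to the evaluation [em] of polynomials at the
   coordinate [X], and to the function [Y]. *)
Variables (em : {rmorphism {poly k} -> C}) (Y : C).
Hypothesis char2 : 2 \in [pchar k].
Hypothesis size_c : size c = (2 * g + 2)%N.
Hypothesis cstE : forall a, cst C a = em a%:P.
Hypothesis em_inj : injective em.
Hypothesis Yeq : Y ^+ 2 - Y = em c.
Hypothesis gen : forall z : C, exists A B D : {poly k}, D != 0 /\ z = (em A + em B * Y) / em D.

Notation nrm := (norm_form c).
Notation X := (em 'X).
Implicit Types (A B D p : {poly k}) (a b : k) (v w : point C).

Lemma em_eq0 p : (em p == 0) = (p == 0).
Proof. by rewrite -(rmorph0 em) (inj_eq em_inj). Qed.

Lemma two_eq0 : 2 = 0 :> C.
Proof.
have /char2_eq0 /(congr1 em) := pchar2_poly char2.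
by rewrite rmorph_nat rmorph0.
Qed.

Lemma conj_mul A B : (em A + em B * Y) * (em A + em B - em B * Y) = em (nrm A B).
Proof.
rewrite /norm_form rmorphB rmorphD !rmorphM -Yeq; ring.
Qed.

Lemma lin_neq0 A B : (A != 0) || (B != 0) -> em A + em B * Y != 0.
Proof.
move=> AB0; apply: contraTneq AB0 => e.
have := conj_mul A B; rewrite e mul0r => /esym/eqP.
by rewrite em_eq0 (norm_form_eq0 size_c) negb_or !negbK.
Qed.

Lemma gen_neq0 z : z != 0 -> exists A B D,
  [/\ D != 0, (A != 0) || (B != 0) & z = (em A + em B * Y) / em D].
Proof.
move=> z0; have [A [B [D [D0 e]]]] := gen z; exists A, B, D; split=> //.
rewrite -negb_and; apply: contra z0 => /andP[/eqP A0 /eqP B0].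
by rewrite e A0 B0 rmorph0 mul0r addr0 mul0r.
Qed.

Lemma em_horner p : em p = (map_poly (cst C) p).[X].
Proof.
elim/poly_ind: p => [|p a IHp]; first by rewrite !rmorph0 horner0.
by rewrite !rmorphD !rmorphM /= map_polyX map_polyC hornerD hornerMX hornerC -IHp /= cstE.
Qed.

Section FinitePoint.
Variable v : point C.

Lemma regular_em p : 0 <= v X -> 0 <= v (em p).
Proof.
move=> vX; elim/poly_ind: p => [|p a IHp]; first by rewrite rmorph0 val0.
by rewrite rmorphD rmorphM -cstE; apply: regularD; rewrite ?val_cst ?regularM.
Qed.

Lemma X_neq0 : X != 0.
Proof. by rewrite em_eq0 polyX_eq0. Qed.

Lemma Y_neq0 : Y != 0.
Proof.
by have := @lin_neq0 0 1; rewrite rmorph0 rmorph1 add0r mul1r oner_neq0 orbT; apply.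
Qed.

(** A pole of [Y] would be a pole of [Y^2 - Y], which is a polynomial in [X]. *)
Lemma regular_Y : 0 <= v X -> 0 <= v Y.
Proof.
move=> vX; rewrite leNgt; apply/negP => vY.
have Y2 : Y ^+ 2 != 0 by rewrite expf_neq0 ?Y_neq0.
have [||_] := @val_addl_lt _ _ v (Y ^+ 2) (- Y) Y2; rewrite ?oppr_eq0 ?Y_neq0 //.
  by rewrite valN valX ?Y_neq0 // mulr2n; lia.
rewrite Yeq valX ?Y_neq0 // => e.
by have := regular_em c vX; rewrite e mulr2n; lia.
Qed.

Definition centre a b := vanishes v (em ('X - a%:P)) && vanishes v (Y - cst C b).

Section Centre.
Variables (a b : k).
Hypothesis vab : centre a b.

Lemma centre_X : 0 <= v X.
Proof.
case/andP: vab => va _.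
have -> : X = em ('X - a%:P) + cst C a by rewrite cstE -rmorphD subrK.
by rewrite regularD ?val_cst ?vanishes_regular.
Qed.

Lemma centre_Y : 0 <= v Y.
Proof. exact/regular_Y/centre_X. Qed.

Lemma centre_horner p : vanishes v (em p - cst C p.[a]).
Proof.
have /factor_theorem [q eq] : root (p - p.[a]%:P) a.
  by rewrite /root !hornerE subrr.
rewrite cstE -rmorphB eq rmorphM; case/andP: vab => va _.
exact/vanishesMr/va/regular_em/centre_X.
Qed.

Lemma centre_eval A B :
  vanishes v (em A + em B * Y - cst C (A.[a] + B.[a] * b)).
Proof.
have -> : em A + em B * Y - cst C (A.[a] + B.[a] * b) =
  (em A - cst C A.[a]) + (Y * (em B - cst C B.[a]) + cst C B.[a] * (Y - cst C b)).
  by rewrite rmorphD rmorphM; ring.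
apply: aboveD; first exact: centre_horner.
apply: aboveD; apply: vanishesMr; rewrite ?centre_Y ?centre_horner ?val_cst //.
by case/andP: vab.
Qed.

Lemma centre_eval_unit A B : A.[a] + B.[a] * b != 0 -> v (em A + em B * Y) = 0.
Proof.
move=> e0; have [_] := val_unitD e0 (centre_eval A B).
by rewrite addrC subrK.
Qed.

Lemma centre_horner_unit p : p.[a] != 0 -> v (em p) = 0.
Proof.
by move=> e; have := @centre_eval_unit p 0; rewrite horner0 rmorph0 !mul0r !addr0; apply.
Qed.

Lemma centre_on_curve : b ^+ 2 - b = c.[a].
Proof.
apply/eqP; rewrite -subr_eq0 -(vanishes_cst v).
have -> : cst C (b ^+ 2 - b - c.[a]) =
  (em c - cst C c.[a]) - (Y + cst C b - 1) * (Y - cst C b).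
  rewrite -Yeq !rmorphB rmorphXn; ring.
apply: aboveD; first exact: centre_horner.
rewrite vanishesN; apply: vanishesMr; last by case/andP: vab.
by rewrite !regularD ?centre_Y ?val_cst ?valN ?val1.
Qed.

End Centre.
End FinitePoint.

(** Up to a power of [X - a], the function [A + B Y] vanishes at no more than one
    of the two points above [a], so its order can be read off its norm. *)
Lemma val_centre a b (z : C) : z != 0 ->
  exists m : int, forall v, centre v a b -> v z = m * v (em ('X - a%:P)).
Proof.
have t0 : em ('X - a%:P) != 0 by rewrite em_eq0 polyXsubC_eq0.
have poly_case D : D != 0 -> exists m : int, forall v, centre v a b ->
    v (em D) = m * v (em ('X - a%:P)).
  move=> D0; have [m [D1]] := multiplicity_XsubC D a; rewrite D0 => /= rD1 eD.
  exists m%:Z => v vab; rewrite eD rmorphM rmorphXn valM ?expf_neq0 ?em_eq0 ?polyXsubC_eq0 //; last first.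
    by apply: contraNneq rD1 => ->; rewrite root0.
  by rewrite (centre_horner_unit vab) // add0r valX // -mulr_natl natz.
move=> /gen_neq0 [A [B [D [D0 AB0 ->]]]].
have [mD emD] := poly_case D D0.
have [j [A1 [B1 [eA eB nr]]]] := primitive_pair a AB0.
have AB1 : (A1 != 0) || (B1 != 0).
  by rewrite -negb_and; apply: contra nr => /andP[/eqP -> /eqP ->]; rewrite root0.
have l0 := lin_neq0 AB1.
suff [m em1] : exists m : int, forall v, centre v a b ->
    v (em A1 + em B1 * Y) = m * v (em ('X - a%:P)).
  exists (j%:Z + m - mD) => v vab.
  rewrite val_div ?em_eq0 ?lin_neq0 // emD //.
  have -> : em A + em B * Y = em ('X - a%:P) ^+ j * (em A1 + em B1 * Y).
    by rewrite eA eB !rmorphM !rmorphXn; ring.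
  by rewrite valM ?expf_neq0 // em1 // valX // mulrBl mulrDl -mulr_natl natz.
have [e0|e0] := eqVneq (A1.[a] + B1.[a] * b) 0; last first.
  by exists 0 => v vab; rewrite (centre_eval_unit vab) // mul0r.
have [m em1] : exists m : int, forall v, centre v a b ->
    v (em (nrm A1 B1)) = m * v (em ('X - a%:P)).
  by apply: poly_case; rewrite (norm_form_eq0 size_c) negb_and.
exists m => v vab; rewrite -em1 // -conj_mul.
have -> : em A1 + em B1 - em B1 * Y = em (A1 + B1) + em (- B1) * Y.
  by rewrite rmorphD rmorphN; ring.
have u : (A1 + B1).[a] + (- B1).[a] * b != 0.
  have -> : (A1 + B1).[a] + (- B1).[a] * b =
     A1.[a] + B1.[a] * b + B1.[a] - 2 * (B1.[a] * b) by rewrite hornerD hornerN; ring.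
  rewrite e0 add0r (char2_eq0 char2) mul0r subr0.
  apply: contra nr => /eqP Ba; rewrite /root Ba eqxx andbT.
  by move: e0; rewrite Ba mul0r addr0 => ->.
rewrite valM // ?(centre_eval_unit vab u) ?addr0 // lin_neq0 //.
by apply: contraNT u; rewrite negb_or !negbK => /andP[/eqP -> /eqP ->]; rewrite !horner0 mul0r addr0.
Qed.

(** All values are multiples of the value of [X - a], and [1] is a value. *)
Lemma centre_uniformizer v a b : centre v a b -> v (em ('X - a%:P)) = 1.
Proof.
move=> vab; have [z z0 vz] := val_uniformizer v.
have [m /(_ v vab)] := val_centre a b z0; rewrite vz => e.
have : 0 < v (em ('X - a%:P)).
  by case/andP: vab; rewrite /above em_eq0 polyXsubC_eq0.
by move=> t0; apply: int_factor1 t0 (esym e).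
Qed.

Lemma centre_unique v w a b : centre v a b -> centre w a b -> v =1 w.
Proof.
move=> vab wab z; have [->|z0] := eqVneq z 0; first by rewrite !val0.
have [m mP] := val_centre a b z0.
by rewrite !mP // (centre_uniformizer vab) (centre_uniformizer wab).
Qed.

(** Otherwise the valuation would be trivial on the rational functions of [X],
    hence on the whole field. *)
Lemma centre_exists v : 0 <= v X -> exists a b, centre v a b.
Proof.
move=> vX; have vY := regular_Y vX.
have [[a va]|no] := classic (exists a, vanishes v (em ('X - a%:P))).
  have [|b] := closed_rootP ('X^2 - 'X - (c.[a])%:P : {poly k}) _.
    by rewrite (size_AS_poly c.[a]).
  rewrite /root !hornerE subr_eq0 => /eqP bP.
  have /factor_theorem [q eq] : root (c - c.[a]%:P) a by rewrite /root !hornerE subrr.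
  have : vanishes v ((Y - cst C b) * (Y - cst C (1 - b))).
    have -> : (Y - cst C b) * (Y - cst C (1 - b)) = em q * em ('X - a%:P).
      rewrite -rmorphM -eq -bP (rmorphB em) -Yeq -cstE !rmorphB rmorphXn rmorph1; ring.
    exact/vanishesMr/va/regular_em.
  case: (boolP (vanishes v (Y - cst C b))) => [vb _|]; first by exists a, b; rewrite /centre va.
  rewrite {1}/above negb_or -leNgt => /andP[b0 vb0].
  move=> vp; exists a, (1 - b); rewrite /centre va /=.
  have -> : Y - cst C (1 - b) = (Y - cst C b)^-1 * ((Y - cst C b) * (Y - cst C (1 - b))).
    by rewrite mulrA mulVf // mul1r.
  by apply: vanishesMr vp; rewrite valV oppr_ge0.
have unit_em D : D != 0 -> v (em D) = 0.
  move=> D0; have [s eD] := closed_field_poly_normal D.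
  have lc0 : lead_coef D != 0 by rewrite lead_coef_eq0.
  rewrite eD -mul_polyC rmorphM -cstE valM ?cst_neq0 ?val_cst ?add0r //; last first.
    by rewrite em_eq0 prodf_seq_neq0; apply/allP => z _; rewrite polyXsubC_eq0.
  elim: s {eD} => [|z s IHs]; first by rewrite big_nil rmorph1 val1.
  rewrite big_cons rmorphM valM ?em_eq0 ?polyXsubC_eq0 //; last first.
    by rewrite prodf_seq_neq0; apply/allP => y _; rewrite polyXsubC_eq0.
  rewrite IHs addr0; apply/eqP; rewrite eq_le regular_em // andbT leNgt.
  by apply/negP => vz; apply: no; exists z; rewrite /above vz orbT.
have [z /gen_neq0 [A [B [D [D0 AB0 ->]]]]] := val_uniformizer v.
have l0 := lin_neq0 AB0.
rewrite val_div ?em_eq0 // unit_em // subr0 => vl.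
have N0 : nrm A B != 0 by rewrite (norm_form_eq0 size_c) negb_and.
have l'0 : em A + em B - em B * Y != 0.
  by apply: contraNneq N0 => e; rewrite -em_eq0 -conj_mul e mulr0.
have := unit_em _ N0; rewrite -conj_mul valM // vl.
have : 0 <= v (em A + em B - em B * Y).
  apply: regularD; last by rewrite valN; apply: regularM => //; apply: regular_em.
  by apply: regularD; apply: regular_em.
lia.
Qed.

Section Infinity.
Variable v : point C.
Hypothesis vX : v X < 0.

Lemma infinity_em p : p != 0 -> v (em p) = v X *+ (size p).-1.
Proof. by move=> p0; rewrite em_horner; apply: (pole_horner vX p0).2. Qed.

(** The leading terms of [Y^2 - Y = c(X)] are [Y^2] and [X^(2 g + 1)]. *)
Lemma infinity_Y : 2 * v Y = v X *+ (2 * g + 1).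
Proof.
have c0 : c != 0 by rewrite -size_poly_gt0 size_c addnS.
have vc : v (em c) = v X *+ (2 * g + 1) by rewrite infinity_em // size_c addn2 addn1.
have Y2 : Y ^+ 2 != 0 by rewrite expf_neq0 ?Y_neq0.
have vY : v Y < 0.
  rewrite ltNge; apply/negP => vY.
  have : 0 <= v (em c) by rewrite -Yeq regularD ?valN // expr2 regularM.
  by rewrite vc leNgt pmulrn_llt0 ?vX ?addn1.
have [||_] := @val_addl_lt _ _ v (Y ^+ 2) (- Y) Y2; rewrite ?oppr_eq0 ?Y_neq0 //.
  by rewrite valN valX ?Y_neq0 // mulr2n; lia.
by rewrite Yeq vc valX ?Y_neq0 // => ->; rewrite mulr2n; ring.
Qed.

End Infinity.

(** In units of half the value of [X], the values of [A] and [B Y] have different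
    parities. *)
Lemma val_infinity (z : C) : z != 0 ->
  exists m : int, forall v, v X < 0 -> 2 * v z = m * v X.
Proof.
move=> /gen_neq0 [A [B [D [D0 AB0 ->]]]].
have l0 := lin_neq0 AB0.
suff [m mP] : exists m : int, forall v, v X < 0 -> 2 * v (em A + em B * Y) = m * v X.
  exists (m - 2 * (size D).-1%:Z) => v vX.
  by rewrite val_div ?em_eq0 // mulrBr mP // (infinity_em vX D0) -mulr_natl natz; ring.
have [A0|A0] := eqVneq A 0.
  have B0 : B != 0 by move: AB0; rewrite A0 eqxx.
  exists (2 * (size B).-1 + (2 * g + 1))%N%:Z => v vX.
  rewrite A0 rmorph0 add0r valM ?em_eq0 ?Y_neq0 // mulrDr infinity_Y // (infinity_em vX B0).
  by rewrite -![v X *+ _]mulr_natl !natz; ring.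
have [B0|B0] := eqVneq B 0.
  exists (2 * (size A).-1)%N%:Z => v vX.
  rewrite B0 rmorph0 mul0r addr0 (infinity_em vX A0) -mulr_natl natz; ring.
have BY0 : em B * Y != 0 by rewrite mulf_neq0 ?em_eq0 ?Y_neq0.
have vA v : v X < 0 -> 2 * v (em A) = (2 * (size A).-1)%N%:Z * v X.
  by move=> vX; rewrite (infinity_em vX A0) -mulr_natl natz; ring.
have vB v : v X < 0 -> 2 * v (em B * Y) = (2 * (size B).-1 + (2 * g + 1))%N%:Z * v X.
  move=> vX; rewrite valM ?em_eq0 ?Y_neq0 // mulrDr infinity_Y // (infinity_em vX B0).
  by rewrite -![v X *+ _]mulr_natl !natz; ring.
have [le|lt] := leqP (2 * (size B).-1 + (2 * g + 1)) (2 * (size A).-1).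
  exists (2 * (size A).-1)%N%:Z => v vX; rewrite -vA //; congr (_ * _).
  have [|||_ //] := @val_addl_lt _ _ v (em A) (em B * Y); rewrite ?em_eq0 //.
  have ltn : (2 * (size B).-1 + (2 * g + 1) < 2 * (size A).-1)%N by move: (size A) (size B) le => a b; lia.
  by move: ltn; rewrite -ltz_nat -(ltr_nM2r vX) -vA // -vB //; lia.
exists (2 * (size B).-1 + (2 * g + 1))%N%:Z => v vX; rewrite -vB //; congr (_ * _).
rewrite addrC; have [|||_ //] := @val_addl_lt _ _ v (em B * Y) (em A); rewrite ?em_eq0 //.
by move: lt; rewrite -ltz_nat -(ltr_nM2r vX) -vA // -vB //; lia.
Qed.

(** The value of [X] divides 2 by [val_infinity], and it is even by
    [infinity_Y]. *)
Lemma infinity_X v : v X < 0 -> v X = -2.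
Proof.
move=> vX; have [z z0 vz] := val_uniformizer v.
have [m /(_ v vX)] := val_infinity z0; rewrite vz => e1.
have := infinity_Y vX; rewrite -mulr_natl natz => e2.
have eX : v X = - (2 * (g%:Z * v X - v Y)) by rewrite mulrBr e2; ring.
suff e : g%:Z * v X - v Y = 1 by rewrite eX e.
apply: (@int_factor1 (- m)); first by move: vX; rewrite eX; lia.
by move: e1; rewrite {1}eX; move: (_ - _) => u; lia.
Qed.

Lemma infinity_unique v w : v X < 0 -> w X < 0 -> v =1 w.
Proof.
move=> vX wX z; have [->|z0] := eqVneq z 0; first by rewrite !val0.
have [m mP] := val_infinity z0.
have := mP v vX; have := mP w wX; rewrite (infinity_X vX) (infinity_X wX); lia.
Qed.

(** * The point at infinity *)

Section PointAtInfinity.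

Let presents (z : C) (t : {poly k} * {poly k} * {poly k}) :=
  let: (A, B, D) := t in (D != 0) && (z == (em A + em B * Y) / em D).

Let presentation z : exists t, presents z t.
Proof.
have [A [B [D [D0 ->]]]] := gen z; exists (A, B, D).
by rewrite /presents D0 eqxx.
Qed.

(** The order at infinity of [A + B Y] is minus the degree of its norm, since
    the place of [k(X)] at infinity is totally ramified. *)
Definition order_infinity (z : C) : int :=
  if z == 0 then 0 else
  let: (A, B, D) := xchoose (presentation z) in
  2 * (size D)%:Z - (size (nrm A B))%:Z - 1.

Lemma order_infinityE A B D : D != 0 -> (A != 0) || (B != 0) ->
  order_infinity ((em A + em B * Y) / em D) =
  2 * (size D)%:Z - (size (nrm A B))%:Z - 1.
Proof.
move=> D0 AB0; rewrite /order_infinity mulf_eq0 invr_eq0 em_eq0 (negPf D0) orbF.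
rewrite (negPf (lin_neq0 AB0)).
case: (xchoose _) (xchooseP (presentation ((em A + em B * Y) / em D))) => [[A' B'] D'].
move=> /andP[D'0 /eqP]; move/(congr1 (fun z => z * (em D * em D'))) => e.
have {}e : em (A * D' - A' * D) + em (B * D' - B' * D) * Y = 0.
  rewrite !rmorphB !rmorphM.
  have -> : em A * em D' - em A' * em D + (em B * em D' - em B' * em D) * Y =
    (em A + em B * Y) * em D' - (em A' + em B' * Y) * em D by ring.
  apply/eqP; rewrite subr_eq0; apply/eqP; move: e.
  rewrite mulrA divfK ?em_eq0 // => ->.
  by rewrite mulrCA mulrA [_ * em D' in LHS]mulrC mulrA; field; rewrite em_eq0.
have /norP[/negPn/eqP eA /negPn/eqP eB] :
    ~~ ((A * D' - A' * D != 0) || (B * D' - B' * D != 0)).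
  by apply/negP => /lin_neq0; rewrite e eqxx.
have : D' ^+ 2 * nrm A B = D ^+ 2 * nrm A' B'.
  move/eqP: eA; rewrite subr_eq0 mulrC [A' * D]mulrC => /eqP eA.
  move/eqP: eB; rewrite subr_eq0 mulrC [B' * D]mulrC => /eqP eB.
  by rewrite -!norm_formZ eA eB.
move=> eN; have N0 : nrm A B != 0 by rewrite (norm_form_eq0 size_c) negb_and.
have N'0 : nrm A' B' != 0.
  by apply: contraNneq N0 => N'0; move/eqP: eN; rewrite N'0 mulr0 mulf_eq0 expf_eq0 (negPf D'0).
have := congr1 (fun p : {poly k} => size p) eN.
rewrite !expr2 !size_mul ?mulf_neq0 //.
have := D0; have := D'0; have := N0; have := N'0; rewrite -!size_poly_gt0.
move: (size D) (size D') (size (nrm A B)) (size (nrm A' B')); clear.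
by move=> d d' m m'; lia.
Qed.

Lemma order_infinity_valuation : discrete_valuation order_infinity.
Proof.
have nz p q : (p != 0) || (q != 0) -> nrm p q != 0.
  by rewrite (norm_form_eq0 size_c) negb_and.
split.
- by rewrite /order_infinity eqxx.
- move=> _ _ /gen_neq0 [A1 [B1 [D1 [D10 AB1 ->]]]] /gen_neq0 [A2 [B2 [D2 [D20 AB2 ->]]]].
  pose A := A1 * A2 + B1 * B2 * c; pose B := A1 * B2 + B1 * A2 + B1 * B2.
  have eN : nrm A B = nrm A1 B1 * nrm A2 B2 by rewrite -norm_formM.
  have AB : (A != 0) || (B != 0).
    by rewrite -negb_and -(norm_form_eq0 size_c) eN mulf_neq0 ?nz.
  have -> : (em A1 + em B1 * Y) / em D1 * ((em A2 + em B2 * Y) / em D2) =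
      (em A + em B * Y) / em (D1 * D2).
    have -> : em A + em B * Y = (em A1 + em B1 * Y) * (em A2 + em B2 * Y).
      by rewrite /A /B !(rmorphD, rmorphM) -Yeq; ring.
    by rewrite rmorphM mulf_div.
  rewrite !order_infinityE ?mulf_neq0 // eN !size_mul ?nz //.
  have := D10; have := D20; have := nz _ _ AB1; have := nz _ _ AB2; rewrite -!size_poly_gt0.
  move: (size D1) (size D2) (size (nrm A1 B1)) (size (nrm A2 B2)); clear.
  by move=> d d' m m'; lia.
- move=> _ _ /gen_neq0 [A1 [B1 [D1 [D10 AB1 ->]]]] /gen_neq0 [A2 [B2 [D2 [D20 AB2 ->]]]].
  have common A' B' D' D : D' != 0 -> D != 0 ->
      (em A' + em B' * Y) / em D' = (em (D * A') + em (D * B') * Y) / em (D * D').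
    by move=> D'0 D0; rewrite !rmorphM; field; rewrite !em_eq0 D0 D'0.
  rewrite (common A1 B1 D1 D2) // (common A2 B2 D2 D1) // [D1 * D2]mulrC -mulrDl.
  have zero D A' B' : D != 0 -> (A' != 0) || (B' != 0) -> (D * A' != 0) || (D * B' != 0).
    by move=> D0; rewrite !mulf_eq0 (negPf D0).
  move/zero: AB1 => /(_ D2 D20); move/zero: AB2 => /(_ D1 D10).
  move: (D2 * A1) (D2 * B1) (D1 * A2) (D1 * B2) => {}A1 {}B1 {}A2 {}B2 AB2 AB1.
  have D0 : D2 * D1 != 0 by rewrite mulf_neq0.
  move: (D2 * D1) D0 => D D0.
  have -> : em A1 + em B1 * Y + (em A2 + em B2 * Y) = em (A1 + A2) + em (B1 + B2) * Y.
    by rewrite !rmorphD; ring.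
  move=> s0.
  have AB : (A1 + A2 != 0) || (B1 + B2 != 0).
    rewrite -negb_and; apply: contra s0 => /andP[/eqP -> /eqP ->].
    by rewrite rmorph0 mul0r addr0 mul0r.
  rewrite !order_infinityE //.
  suff : (size (nrm (A1 + A2) (B1 + B2)) <= maxn (size (nrm A1 B1)) (size (nrm A2 B2)))%N.
    move: (size (nrm _ _)) (size (nrm A1 _)) (size (nrm A2 _)) (size D); clear.
    by move=> m m1 m2 d; lia.
  set m := maxn _ _.
  have := leq_maxl (size (nrm A1 B1)) (size (nrm A2 B2)); rewrite -/m.
  have := leq_maxr (size (nrm A1 B1)) (size (nrm A2 B2)); rewrite -/m.
  move: m => m; rewrite !(size_norm_form_le size_c) => /andP[a2 b2] /andP[a1 b1].
  have sA := size_polyD A1 A2; have sB := size_polyD B1 B2.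
  apply/andP; split; first by
    move: sA a1 a2; clear; move: (size _) (size A1) (size A2) => x y z; lia.
  have [//|s_neq0 /=] := eqVneq (B1 + B2) 0.
  case: (eqVneq B1 0) b1 => [B10 _|_ /= b1].
    by move: b2; rewrite B10 add0r in s_neq0 *; rewrite (negPf s_neq0).
  case: (eqVneq B2 0) b2 => [B20 _|_ /= b2]; first by rewrite B20 addr0.
  by move: sB b1 b2; clear; move: (size _) (size B1) (size B2) => x y z; lia.
- move=> a a0.
  have -> : cst C a = (em a%:P + em 0 * Y) / em 1%:P.
    by rewrite rmorph0 mul0r addr0 -!cstE rmorph1 divr1.
  rewrite order_infinityE ?polyC_eq0 ?oner_neq0 ?a0 // (size_norm_form0 size_c).
  by rewrite !size_polyC a0 oner_neq0.
(* [X^g / Y], written with the denominator [c = Y^2 - Y], up to sign. *)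
exists ((em 'X^g + em (- 'X^g) * Y) / em c).
have c0 : c != 0 by rewrite -size_poly_gt0 size_c addnS.
have X0 : 'X^g != 0 :> {poly k} by rewrite -size_poly_gt0 size_polyXn.
rewrite order_infinityE ?X0 // size_c (size_norm_form size_c) ?oppr_eq0 // size_polyN size_polyXn.
by clear; lia.
Qed.

Definition point_infinity : point C := Point order_infinity_valuation.

Lemma point_infinityX : point_infinity X < 0.
Proof.
rewrite /point_infinity /=.
have -> : X = (em 'X + em 0 * Y) / em 1%:P.
  by rewrite rmorph0 mul0r addr0 -cstE rmorph1 divr1.
rewrite order_infinityE ?polyC_eq0 ?oner_neq0 ?polyX_eq0 //.
by rewrite (size_norm_form0 size_c) size_polyX size_polyC oner_neq0.
Qed.

End PointAtInfinity.

(** * The cover attached to an odd power norm *)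

Section OddTorsionFunction.
Variables (A B : {poly k}) (n : nat).
Hypotheses (rB : ~~ root B 0) (normE : nrm A B = 'X^n) (n_odd : odd n).

Notation beta := (em A + em B * Y).
Notation beta' := (em A + em B * Y + em B).

Let B_neq0 : B != 0.
Proof. by apply: contraNneq rB => ->; rewrite root0. Qed.

Let n_gt0 : (0 < n)%N.
Proof. by case: n n_odd. Qed.

Let sizeB : (2 * size B + 2 * g = n.+1)%N.
Proof.
have := odd_norm_degree char2 size_c B_neq0 normE n_odd.
by have := B_neq0; rewrite -size_poly_gt0; move: (size B) => b; lia.
Qed.

Let sub_add (x y : C) : x - y = x + y.
Proof.
have -> : x - y = x + y - 2 * y by ring.
by rewrite two_eq0 mul0r subr0.
Qed.

Let beta_mul : beta * beta' = X ^+ n.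
Proof. by rewrite -rmorphXn -normE -conj_mul sub_add; ring. Qed.

Let beta_sq : beta ^+ 2 + beta' ^+ 2 = em B ^+ 2.
Proof.
have -> : beta ^+ 2 + beta' ^+ 2 = em B ^+ 2 + 2 * (beta ^+ 2 + beta * em B).
  by ring.
by rewrite two_eq0 mul0r addr0.
Qed.

Let beta_neq0 : beta != 0.
Proof. by rewrite lin_neq0 // B_neq0 orbT. Qed.

Let beta'_neq0 : beta' != 0.
Proof.
have : beta * beta' != 0 by rewrite beta_mul expf_neq0 ?X_neq0.
by rewrite mulf_eq0 negb_or => /andP[].
Qed.

Let f : C := beta / beta'.

Let f_neq0 : f != 0.
Proof. by rewrite mulf_neq0 ?invr_neq0. Qed.

Let val_f v : v f = v beta - v beta'.
Proof. by rewrite val_div. Qed.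

Lemma f_sub1 : f - 1 = em B / beta'.
Proof.
rewrite sub_add /f -(divff beta'_neq0) -mulrDl addrA -[beta + beta]mulr2n.
by rewrite -[beta *+ 2]mulr_natl two_eq0 mul0r add0r.
Qed.

Let val_mul v : v beta + v beta' = v X *+ n.
Proof. by rewrite -valM // beta_mul valX ?X_neq0. Qed.

Let regular_beta v : 0 <= v X -> 0 <= v beta.
Proof.
by move=> vX; apply: regularD; [|apply: regularM]; by [apply: regular_em | apply: regular_Y].
Qed.

Let regular_beta' v : 0 <= v X -> 0 <= v beta'.
Proof. by move=> vX; apply: regularD; [apply: regular_beta | apply: regular_em]. Qed.

Let val_beta_away v a b : a != 0 -> centre v a b -> v beta = 0 /\ v beta' = 0.
Proof.
move=> a0 vab; have vX := centre_X vab.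
have vX0 : v X = 0 by rewrite (centre_horner_unit vab) ?hornerX.
have /eqP := val_mul v; rewrite vX0 mul0rn.
by rewrite paddr_eq0 ?regular_beta ?regular_beta' // => /andP[/eqP ? /eqP].
Qed.

Lemma simple_root_val v a b (p : {poly k}) :
  centre v a b -> p.[a] = 0 -> p^`().[a] != 0 -> v (em p) = 1.
Proof.
move=> vab pa p'a; have /factor_theorem [q eq] : root p a by apply/rootP.
have qa : q.[a] != 0.
  by move: p'a; rewrite eq derivM derivXsubC !hornerE subrr mulr0 add0r.
have q0 : q != 0 by apply: contraNneq qa => ->; rewrite horner0.
rewrite eq rmorphM valM ?em_eq0 ?polyXsubC_eq0 // (centre_horner_unit vab qa).
by rewrite (centre_uniformizer vab).
Qed.

(** Above any [d <> 0], the function [f - d] is, up to a unit, a factor of a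
    polynomial in [X] whose nonzero roots are simple. *)
Lemma unramified_away v a b d : a != 0 -> centre v a b ->
  0 < v (f - cst C d) -> v (f - cst C d) = 1.
Proof.
move=> a0 vab vfd; have [vb vb'] := val_beta_away a0 vab.
have vf : v f = 0 by rewrite val_f vb vb' subr0.
have c2 := char2_eq0 char2.
have n1 : n%:R = 1 :> k.
  by rewrite -(odd_double_half n) n_odd -mul2n natrD natrM c2 mul0r addr0.
have [d0|d0] := eqVneq d 0; first by move: vfd; rewrite d0 rmorph0 subr0 vf.
have norm' : (A^`() * B + A * B^`() - B ^+ 2 * c^`()).[a] = a ^+ n.-1.
  have := congr1 (fun p : {poly k} => p^`().[a]) normE.
  rewrite /norm_form derivXn derivB derivD !expr2 !derivM hornerMn hornerXn -mulr_natl n1 mul1r => <-.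
  rewrite !(hornerD, hornerN, hornerM).
  set x := A.[a]; set x' := A^`().[a]; set y := B.[a]; set y' := B^`().[a].
  set z := c.[a]; set z' := c^`().[a].
  have -> : x' * x + x * x' + (x' * y + x * y') - ((y' * y + y * y') * z + y * y * z') =
    x' * y + x * y' - y * y * z' + 2 * (x * x' - y * y' * z) by ring.
  by rewrite c2 mul0r addr0.
have root_val p : 0 < v (em p) -> p.[a] = 0.
  by move=> vp; apply/eqP; apply: contraTT vp => pa; rewrite (centre_horner_unit vab).
have b'0 : 0 <= v beta'^-1 by rewrite valV vb'.
have [d1|d1] := eqVneq d 1.
  have eB : v (f - cst C d) = v (em B) by rewrite d1 rmorph1 f_sub1 val_div ?em_eq0 // vb' subr0.
  move: vfd; rewrite eB => /root_val Ba; apply: (simple_root_val vab Ba).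
  move: norm'; rewrite !hornerE Ba mulr0 add0r expr0n mul0r subr0 => e.
  have : a ^+ n.-1 != 0 by rewrite expf_neq0.
  by rewrite -e mulf_eq0 negb_or => /andP[].
pose ka := d + d^-1.
pose Psi := B ^+ 2 - ka *: 'X^n.
have d_inv : d - d^-1 != 0.
  apply: contra d1; rewrite subr_eq0 => /eqP e.
  have : (d - 1) ^+ 2 = 0.
    have -> : (d - 1) ^+ 2 = d * d - 2 * d + 1 by ring.
    by rewrite {2}e divff // c2 mul0r subr0 -[1 + 1]/(2 : k) c2.
  by move/eqP; rewrite expf_eq0 /= subr_eq0.
have PsiE : em Psi = (beta - cst C d * beta') * (beta - cst C d^-1 * beta').
  rewrite /Psi rmorphB rmorphXn -mul_polyC rmorphM rmorphXn -cstE -beta_mul /ka rmorphD.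
  have e1 : cst C d * cst C d^-1 = 1 by rewrite -rmorphM divff // rmorph1.
  have -> : (beta - cst C d * beta') * (beta - cst C d^-1 * beta') =
    beta ^+ 2 + (cst C d * cst C d^-1) * beta' ^+ 2 -
    (cst C d + cst C d^-1) * (beta * beta') by ring.
  by rewrite e1 mul1r beta_sq.
have fd0 : f - cst C d != 0 by apply: contraTneq vfd => ->; rewrite val0.
have fdE : beta - cst C d * beta' = (f - cst C d) * beta'.
  by rewrite mulrBl /f divfK.
have g0 : beta - cst C d^-1 * beta' =
  cst C (d - d^-1) * beta' + (beta - cst C d * beta') by rewrite rmorphB; ring.
have [||u0 vu] := @val_addl_small _ _ v (cst C (d - d^-1) * beta') (beta - cst C d * beta').
- by rewrite mulf_neq0 ?cst_neq0.
- rewrite fdE mulrC; apply: vanishesMr; last first.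
    rewrite [_ * beta']mulrC; apply: vanishesMr; first by rewrite vb'.
    by rewrite /above vfd orbT.
  by rewrite valV valM ?cst_neq0 // val_cst vb' addr0.
have PsiV : v (em Psi) = v (f - cst C d).
  have fn0 : beta - cst C d * beta' != 0 by rewrite fdE mulf_neq0.
  by rewrite PsiE g0 valM // vu valM ?cst_neq0 // val_cst vb' !addr0 fdE valM // vb' addr0.
have Psi_a := root_val Psi; rewrite -PsiV; apply: (simple_root_val vab).
  by apply: Psi_a; rewrite PsiV.
rewrite /Psi derivB expr2 derivM derivZ derivXn !hornerE hornerMn hornerXn -[_ *+ n]mulr_natl n1 mul1r.
have -> : B^`().[a] * B.[a] + B.[a] * B^`().[a] = 2 * (B.[a] * B^`().[a]) by ring.
rewrite c2 mul0r add0r oppr_eq0 mulf_neq0 ?expf_neq0 //.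
have -> : ka = (d - d^-1) + 2 * d^-1 by rewrite /ka; ring.
by rewrite c2 mul0r addr0.
Qed.

(** If the values of [beta] and [beta'] were not both [- n], one of them would be
    smaller than [- n], hence smaller than that of the difference [B]; but then
    the two values would be equal, and their sum is [- 2 n]. *)
Let val_infinity_beta v : v X < 0 -> v beta = - n%:Z /\ v beta' = - n%:Z.
Proof.
move=> vX; have := val_mul v; rewrite (infinity_X vX) -[_ *+ n]mulr_natl natz => e.
have vB : v (em B) = 2 * g%:Z + 1 - n%:Z.
  rewrite (infinity_em vX B_neq0) (infinity_X vX).
  have := sizeB; have := B_neq0; rewrite -size_poly_gt0.
  by move: (size B) => s; lia.
have close (x y : int) : x < - n%:Z -> (x < v (em B) -> y = x) -> x + y = n%:Z * -2 -> False.
  by rewrite vB; clear; move=> lt h e; have : y = x; [apply: h|]; lia.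
have [lt|ge] := ltP (v beta) (- n%:Z).
  exfalso; apply: (close _ (v beta') lt _ e) => ltB.
  by have [|||_] := @val_addl_lt _ _ v beta (em B); rewrite ?em_eq0.
have [lt|ge'] := ltP (v beta') (- n%:Z).
  rewrite addrC in e; exfalso; apply: (close _ (v beta) lt _ e) => ltB.
  have [|||_] := @val_addl_lt _ _ v beta' (- em B); rewrite ?oppr_eq0 ?em_eq0 ?valN //.
  by rewrite addrK.
move: (v beta) (v beta') e ge ge'; clear; move=> x y; lia.
Qed.

Lemma val_infinity_f1 v : v X < 0 -> v (f - 1) = (2 * g + 1)%N%:Z.
Proof.
move=> vX; have [_ vb'] := val_infinity_beta vX.
rewrite f_sub1 val_div ?em_eq0 // vb' (infinity_em vX B_neq0) (infinity_X vX).
have := sizeB; have := B_neq0; rewrite -size_poly_gt0.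
by move: (size B) => s; lia.
Qed.

Section Poles.
Variable b : k.
Hypothesis b_curve : b ^+ 2 - b = c.[0].
Hypothesis beta'_b : A.[0] + B.[0] * b + B.[0] = 0.

Let B00 : B.[0] != 0. Proof. exact: rB. Qed.

Let val_X v b' : centre v 0 b' -> v X = 1.
Proof. by move=> vab; have := centre_uniformizer vab; rewrite polyC0 subr0. Qed.

Let beta'E : beta' = em (A + B) + em B * Y.
Proof. by rewrite rmorphD; ring. Qed.

Let val_pole v : centre v 0 b -> v beta = 0 /\ v beta' = n%:Z.
Proof.
move=> vab; have vb : v beta = 0.
  apply: (centre_eval_unit vab); apply: contra B00 => /eqP e.
  by move: beta'_b; rewrite e add0r => ->.
by have := val_mul v; rewrite vb add0r (val_X vab) => ->; rewrite natz.
Qed.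

Let val_zero v : centre v 0 (b + 1) -> v beta = n%:Z /\ v beta' = 0.
Proof.
move=> vab; have vb' : v beta' = 0.
  rewrite beta'E; apply: (centre_eval_unit vab); rewrite hornerD.
  have -> : A.[0] + B.[0] + B.[0] * (b + 1) = (A.[0] + B.[0] * b + B.[0]) + B.[0] by ring.
  by rewrite beta'_b add0r.
by have := val_mul v; rewrite vb' addr0 (val_X vab) => ->; rewrite natz.
Qed.

Lemma point_cases v : [\/ v X < 0, exists a b', a != 0 /\ centre v a b',
  centre v 0 b | centre v 0 (b + 1)].
Proof.
have [vX|/centre_exists [a [b' vab]]] := ltP (v X) 0; first by constructor 1.
have [a0|a0] := eqVneq a 0; last by constructor 2; exists a, b'.
move: vab; rewrite a0 => vab.
have /eqP : (b' - b) * (b' - (b + 1)) = 0.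
  have -> : (b' - b) * (b' - (b + 1)) = (b' ^+ 2 - b') - (b ^+ 2 - b) - 2 * (b * (b' - b)) by ring.
  by rewrite (centre_on_curve vab) b_curve subrr (char2_eq0 char2) mul0r subr0.
rewrite mulf_eq0 !subr_eq0 => /orP[] /eqP e; first by constructor 3; rewrite -e.
by constructor 4; rewrite -e.
Qed.

Lemma val_f_pole v : centre v 0 b -> v f = - n%:Z.
Proof. by move=> /val_pole [vb vb']; rewrite val_f vb vb' sub0r. Qed.

Lemma val_f_zero v : centre v 0 (b + 1) -> v f = n%:Z.
Proof. by move=> /val_zero [vb vb']; rewrite val_f vb vb' subr0. Qed.

Let val_f_away v : (v X < 0 \/ exists a b', a != 0 /\ centre v a b') -> v f = 0.
Proof.
case=> [/val_infinity_beta [vb vb']|[a [b' [a0 /(val_beta_away a0) [vb vb']]]]];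
  by rewrite val_f vb vb' subrr.
Qed.

(** Each clause of the definition of a generalized Lame cover is read off from
    this case distinction. *)
Lemma ram_cases (a : option k) v e : ram f a v e ->
  [\/ [/\ a = None, centre v 0 b & e = n],
      [/\ a = Some 0, centre v 0 (b + 1) & e = n],
      [/\ a = Some 1, v X < 0 & e = (2 * g + 1)%N] |
      [/\ a != None, a != Some 0 & e = 1%N]].
Proof.
case=> e0; case: a => [d|] /= ve; last first.
  move: e0; rewrite -ltz_nat -ve valV.
  case: (point_cases v) => [vX|va|vab|vab].
  - by rewrite val_f_away ?oppr0 //; left.
  - by rewrite val_f_away ?oppr0 //; right.
  - by constructor 1; split=> //; move: ve; rewrite valV val_f_pole // opprK => -[].
  - by rewrite val_f_zero // oppr_gt0.
have [d0|d0] := eqVneq d 0.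
  move: ve e0; rewrite d0 rmorph0 subr0 -ltz_nat => ve; rewrite -ve.
  case: (point_cases v) => [vX|va|vab|vab].
  - by rewrite val_f_away //; left.
  - by rewrite val_f_away //; right.
  - by rewrite val_f_pole // oppr_gt0.
  - by constructor 2; split=> //; move: ve; rewrite val_f_zero // => -[].
have vfd : 0 < v (f - cst C d) by rewrite ve.
have Sd0 : Some d != Some 0 by apply: contra d0 => /eqP [->].
have nvf : vanishes v f -> False.
  move=> vf; suff : vanishes v (cst C d) by rewrite vanishes_cst (negPf d0).
  have -> : cst C d = - (f - cst C d) + f by rewrite opprB subrK.
  by apply: aboveD => //; rewrite vanishesN /above vfd orbT.
case: (point_cases v) => [vX|[a [b' [a0 vab]]]|vab|vab].
- have d1 : d = 1.
    have : vanishes v ((f - cst C 1) - (f - cst C d)).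
      apply: aboveD; last by rewrite vanishesN /above vfd orbT.
      by apply/orP; right; rewrite rmorph1 val_infinity_f1 // ltz_nat addn1.
    have -> : (f - cst C 1) - (f - cst C d) = cst C (d - 1) by rewrite rmorphB; ring.
    by rewrite vanishes_cst subr_eq0 => /eqP.
  constructor 3; split=> //; first by rewrite d1.
  by move: ve; rewrite d1 rmorph1 val_infinity_f1 // => -[].
- constructor 4; split=> //.
  by move: ve; rewrite (unramified_away a0 vab vfd) => -[].
- have vf := val_f_pole vab.
  have vf0 : v f < 0 by rewrite vf oppr_lt0.
  have [|||_ e1] := @val_addl_lt _ _ v f (- cst C d); rewrite ?oppr_eq0 ?cst_neq0 ?valN ?val_cst //.
  by move: vfd; rewrite e1 ltNge ltW.
- by case: nvf; apply/orP; right; rewrite (val_f_zero vab).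
Qed.

(** ** Degree *)

Let sE : f + f^-1 = em (B ^+ 2) / X ^+ n.
Proof.
rewrite -beta_mul /f rmorphXn -beta_sq.
by field; rewrite beta_neq0 beta'_neq0.
Qed.

Let s := f + f^-1.

Let sX : s * X ^+ n = em (B ^+ 2).
Proof. by rewrite /s sE divfK // expf_neq0 ?X_neq0. Qed.

Let s_neq0 : s != 0.
Proof. by rewrite /s sE mulf_neq0 ?invr_neq0 ?expf_neq0 ?X_neq0 // em_eq0 expf_neq0. Qed.

Notation kf := (in_simple_ext (cst C) f).
Notation span := (power_span (cst C) f X n).

Let simple_s : kf s.
Proof. by apply: simpleD; [|apply: simpleV]; apply: simple_gen. Qed.

Let span_n : span (X ^+ n).
Proof.
have sz : (size (B ^+ 2)%R <= n)%N.
  rewrite expr2 size_mul // -ltnS.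
  by have := sizeB; have := B_neq0; rewrite -size_poly_gt0; move: (size B); clear; lia.
have -> : X ^+ n = s^-1 * em (B ^+ 2) by rewrite -sX mulKf.
apply: spanZ; first exact: simpleV.
exists (fun i : 'I_n => cst C (B ^+ 2)`_i); split=> [i|]; first exact: simple_cst.
rewrite (em_horner (B ^+ 2)) (horner_coef_wide _ (leq_trans (size_poly _ _) sz)).
by apply: eq_bigr => i _; rewrite coef_map.
Qed.

Let span_em p : span (em p).
Proof. by rewrite (em_horner p); apply: (span_horner n_gt0 span_n). Qed.

(** [X] is a root of the polynomial [s x^n - B(x)^2] over k(f), which has no root
    [r] in the constant field; so its value at [r] is a nonzero multiple of
    [X - r], with a polynomial in [X] as cofactor. *)
Let span_inv_lin r : span (em ('X - r%:P))^-1.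
Proof.
have /factor_theorem [q1 e1] : root ('X^n - (r ^+ n)%:P) r.
  by rewrite /root !hornerE subrr.
have /factor_theorem [q2 e2] : root (B ^+ 2 - (B.[r] ^+ 2)%:P) r.
  by rewrite /root !hornerE subrr.
pose w := s * cst C (r ^+ n) - cst C (B.[r] ^+ 2).
have kw : kf w.
  by apply: simpleB; [apply: simpleM => //|]; apply: simple_cst.
have wE : w = (em q2 - s * em q1) * em ('X - r%:P).
  have e1' : em q1 * em ('X - r%:P) = X ^+ n - cst C (r ^+ n).
    by rewrite -rmorphM -e1 rmorphB rmorphXn cstE.
  have e2' : em q2 * em ('X - r%:P) = s * X ^+ n - cst C (B.[r] ^+ 2).
    by rewrite -rmorphM -e2 rmorphB sX cstE.
  by rewrite mulrBl -mulrA e1' e2' /w; ring.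
have w0 : w != 0.
  apply: contraTneq isT => w0.
  have ws : s * cst C (r ^+ n) = cst C (B.[r] ^+ 2).
    by apply/eqP; rewrite -subr_eq0 -/w w0.
  have e : em (B ^+ 2 * (r ^+ n)%:P) = em ((B.[r] ^+ 2)%:P * 'X^n).
    by rewrite rmorphM [RHS]rmorphM -!cstE -ws -sX [em 'X^n]rmorphXn mulrAC.
  have {}e := em_inj e.
  have := congr1 (horner^~ 0) e; rewrite !hornerE expr0n (gtn_eqF n_gt0) /= mulr0.
  move/eqP; rewrite mulf_eq0 expf_eq0 (negPf B00) /= expf_eq0 n_gt0 /= => /eqP r0.
  move/eqP: e; rewrite r0 expr0n (gtn_eqF n_gt0) mulr0 eq_sym mulf_eq0 polyC_eq0 expf_eq0 (negPf B00) /=.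
  by rewrite -size_poly_eq0 size_polyXn.
have l0 : em ('X - r%:P) != 0 by rewrite em_eq0 polyXsubC_eq0.
have -> : (em ('X - r%:P))^-1 = w^-1 * (em q2 - s * em q1).
  by apply: (mulIf l0); rewrite mulVf // -mulrA -wE mulVf.
apply: spanZ; first exact: simpleV.
rewrite -mulN1r mulrA; apply: spanD => //; apply: spanZ => //.
by rewrite -(rmorph1 (cst C)) -rmorphN; apply: simpleM => //; apply: simple_cst.
Qed.

Let span_inv p : span (em p)^-1.
Proof.
have [r ->] := closed_field_poly_normal p.
rewrite -mul_polyC rmorphM invfM; apply: (spanM n_gt0 span_n) => //.
  by rewrite -cstE; apply: (span_simple _ n_gt0); apply/simpleV/simple_cst.
elim: r => [|z r IHr]; first by rewrite big_nil rmorph1 invr1 -(rmorph1 em).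
by rewrite big_cons rmorphM invfM; apply: (spanM n_gt0 span_n).
Qed.

Let f_neq1 : f - 1 != 0.
Proof. by rewrite f_sub1 mulf_neq0 ?invr_neq0 // em_eq0. Qed.

(** Solving [f beta' = beta] for [Y]. *)
Let span_Y : span Y.
Proof.
have -> : Y = f / (1 - f) + -1 * (em A / em B).
  rewrite mulN1r.
  have f1 : 1 - f != 0 by rewrite -oppr_eq0 opprB.
  have B0 : em B != 0 by rewrite em_eq0.
  have e : beta * (1 - f) = f * em B.
    have : f * beta' = beta by rewrite /f divfK.
    by move=> e; rewrite mulrBr mulr1 -{1}e; ring.
  apply: (mulfI B0); rewrite mulrBr [em B * (em A / _)]mulrC divfK //.
  rewrite mulrA [em B * f]mulrC -e mulfK //; ring.
have kc a : kf (cst C a) by apply: simple_cst.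
apply: spanD.
  apply: (span_simple _ n_gt0); apply: simpleM; first exact: simple_gen.
  apply: simpleV; apply: simpleB; last exact: simple_gen.
  by rewrite -(rmorph1 (cst C)).
by apply: spanZ; [rewrite -(rmorph1 (cst C)) -rmorphN | apply: (spanM n_gt0 span_n)].
Qed.

(** A relation with coefficients in k(f) is impossible: the terms have pairwise
    distinct values at the pole of [f], since nonzero elements of k(f) have values
    divisible by [n] there. *)
Lemma ext_degree_f v : centre v 0 b -> ext_degree (cst C) f n.
Proof.
move=> vb; exists (fun i => X ^+ i); split.
  move=> z; have [A1 [B1 [D [D0 ->]]]] := gen z.
  by apply: (spanM n_gt0 span_n) => //; apply: spanD => //; apply: (spanM n_gt0 span_n).
move=> d kd /(@distinct_val_sum _ _ v _ (fun i => d i * X ^+ i)) h i.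
have vf := val_f_pole vb; have vX := val_X vb.
have Xi j : X ^+ j != 0 by rewrite expf_neq0 ?X_neq0.
suff /h/(_ i)/eqP : forall i j, d i * X ^+ i != 0 -> d j * X ^+ j != 0 ->
    v (d i * X ^+ i) = v (d j * X ^+ j) -> i = j.
  by rewrite mulf_eq0 (negPf (Xi i)) orbF => /eqP.
move=> {h i} i j; rewrite !mulf_eq0 !negb_or => /andP[di _] /andP[dj _].
have vf0 : v f < 0 by rewrite vf oppr_lt0.
have [mi ei] := val_simple vf0 (kd i) di; have [mj ej] := val_simple vf0 (kd j) dj.
rewrite !valM // ei ej !valX ?X_neq0 // vX vf !mulrN -!mulNr.
move/(congr1 (fun z => (z %% n)%Z)); rewrite !modzMDl !natz !modz_nat !modn_small //.
by move=> [e]; apply: val_inj.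
Qed.

Lemma lame_cover (P P0 Poo : point C) : centre P 0 b -> centre P0 0 (b + 1) -> Poo X < 0 ->
  (0 < g)%N -> gen_lame_cover g n f P P0.
Proof.
move=> vP vP0 vPoo g0.
have n1 : odd (2 * g + 1) by rewrite mul2n addn1 /= odd_double.
have tameE e : odd e -> [pchar k]^'.-nat e by rewrite pchar2'_nat.
split; first exact: ext_degree_f vP.
- move=> a v e /ram_cases [[_ _ ->]|[_ _ ->]|[_ _ ->]|[_ _ ->]]; exact: tameE.
- move=> a; rewrite !inE !negb_or => /and3P[aoo a0 a1] v e.
  by case/ram_cases => [[ea _ _]|[ea _ _]|[ea _ _]|[_ _ ->]] //;
    move: aoo a0 a1; rewrite ea eqxx.
- split; split.
  + by split=> //=; rewrite valV (val_f_pole vP) opprK.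
  + by move=> v e /ram_cases [[_ vc _]|[]|[]|[/eqP]] //; apply: (centre_unique vc vP).
  + by split=> //=; rewrite rmorph0 subr0 (val_f_zero vP0).
  + move=> v e /ram_cases [[]|[_ vc _]|[[/esym/eqP]]|[_ /eqP]] //; first exact: (centre_unique vc vP0).
    by rewrite oner_eq0.
exists Poo; split.
- by split; rewrite ?addn1 //= rmorph1 val_infinity_f1 // addn1.
- by rewrite addn1 eqSS -lt0n muln_gt0.
move=> v e /ram_cases [[]|[[/eqP]]|[_ vX _ _]|[_ _ -> /eqP]] //.
  by rewrite oner_eq0.
exact: (infinity_unique vX vPoo).
Qed.

End Poles.
End OddTorsionFunction.
End ArtinSchreierCurve.

(** * The hyperelliptic curve *)

Lemma common_denominator (K : fieldType) (u v u' v' y : K) : v != 0 -> v' != 0 ->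
  u / v + u' / v' * y = (u * v' + u' * v * y) / (v * v').
Proof. by move=> v0 v'0; field; rewrite v0 v'0. Qed.

Section HyperellipticPresentation.
Variables (k : closedFieldType) (g : nat) (x0 : k).
Notation C := (hyperell_curve k g).

(** Polynomials in the coordinate [X - x0]. *)
Definition hyperell_poly : {rmorphism {poly k} -> C} :=
  hyperell_kX k g \o @FracField.tofrac {poly k} \o comp_poly ('X - x0%:P).

Let polyE p : hyperell_poly p = hyperell_kX k g (FracField.tofrac (p \Po ('X - x0%:P))).
Proof. by []. Qed.

Let shiftK (p : {poly k}) : (p \Po ('X + x0%:P)) \Po ('X - x0%:P) = p.
Proof.
by rewrite -comp_polyA comp_polyD comp_polyX comp_polyC subrK comp_polyXr.
Qed.

Lemma hyperell_poly_cst a : cst C a = hyperell_poly a%:P.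
Proof. by rewrite polyE comp_polyC. Qed.

Lemma hyperell_polyX : hyperell_poly 'X = hyperell_X k g - cst C x0.
Proof. by rewrite polyE comp_polyX tofracB rmorphB. Qed.

Lemma hyperell_poly_inj : injective hyperell_poly.
Proof.
move=> p q; rewrite !polyE => /fmorph_inj /eqP; rewrite tofrac_eq => /eqP e.
have unshift (r : {poly k}) : r = (r \Po ('X - x0%:P)) \Po ('X + x0%:P).
  by rewrite -comp_polyA comp_polyB comp_polyX comp_polyC addrK comp_polyXr.
by rewrite (unshift p) e -unshift.
Qed.

Lemma hyperell_poly_eq :
  hyperell_Y k g ^+ 2 - hyperell_Y k g =
  hyperell_poly (('X + x0%:P) ^+ (2 * g + 1)).
Proof.
rewrite hyperell_eq polyE rmorphXn /= comp_polyD comp_polyX comp_polyC subrK.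
by rewrite tofracXn rmorphXn.
Qed.

Lemma hyperell_poly_gen (z : C) : exists A B D : {poly k}, D != 0 /\
  z = (hyperell_poly A + hyperell_poly B * hyperell_Y k g) / hyperell_poly D.
Proof.
have [a [b ->]] : exists a b, z = hyperell_kX k g a + hyperell_kX k g b * hyperell_Y k g.
  by exists ((z : {poly _})`_0), ((z : {poly _})`_1); apply/AS_basis.
have [p [q [q0 ->]]] := fraction_divP a; have [p' [q' [q'0 ->]]] := fraction_divP b.
pose up (r : {poly k}) := r \Po ('X + x0%:P).
have upE r : hyperell_poly (up r) = hyperell_kX k g (FracField.tofrac r).
  by rewrite polyE shiftK.
exists (up (p * q')), (up (p' * q)), (up (q * q')); split.
  apply/eqP => e; have := upE (q * q'); rewrite e rmorph0 => /esym/eqP.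
  by rewrite fmorph_eq0 tofrac_eq0 mulf_eq0 (negPf q0) (negPf q'0).
rewrite !upE !tofracM !rmorphM !fmorphV.
by apply: common_denominator; rewrite fmorph_eq0 tofrac_eq0.
Qed.

End HyperellipticPresentation.

Unset Implicit Arguments.

Theorem theoremB2p1
  (k : closedFieldType) (j : {rmorphism 'F_2 -> k}) (k_alg : integralRange j)
  (g : nat) (g_gt0 : (0 < g)%N)
  (P : point (hyperell_curve k g)) (P_affine : ~ at_infinity P) :
  gen_lame_curve g P (hyperell_involution (pchar2_of_F2 j) P).
Proof.
have char2 := pchar2_of_F2 j; have two0 := char2_eq0 char2.
have size_c x0 : size (('X + x0%:P) ^+ (2 * g + 1) : {poly k}) = (2 * g + 2)%N.
  by rewrite -[x0]opprK polyCN size_exp_XsubC addn2 addn1.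
have [x0 [b Pb]] : exists x0 b, centre (hyperell_poly g x0) (hyperell_Y k g) P 0 b.
  have PX : 0 <= P (hyperell_poly g 0 'X).
    rewrite hyperell_polyX rmorph0 subr0 leNgt; apply/negP => PX.
    by apply: P_affine; left.
  have [a [b /andP[Pa Pb]]] := centre_exists char2 (size_c 0) (@hyperell_poly_cst k g 0)
    (@hyperell_poly_inj k g 0) (@hyperell_poly_eq k g 0) (@hyperell_poly_gen k g 0) PX.
  exists a, b; rewrite /centre Pb andbT; move: Pa.
  by rewrite !rmorphB !hyperell_polyX -!hyperell_poly_cst !rmorph0 !subr0.
pose em := hyperell_poly g x0; pose c : {poly k} := ('X + x0%:P) ^+ (2 * g + 1).
have cstE : forall a, cst _ a = em a%:P := @hyperell_poly_cst k g x0.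
have em_inj : injective em := @hyperell_poly_inj k g x0.
have Yeq := @hyperell_poly_eq k g x0; have gen := @hyperell_poly_gen k g x0.
have b_curve : b ^+ 2 - b = c.[0] := centre_on_curve char2 (size_c x0) cstE em_inj Yeq Pb.
have [A [B [n [rB normE n_odd beta'_b]]]] : exists A B n,
    [/\ ~~ root B 0, norm_form c A B = 'X^n, odd n & A.[0] + B.[0] * b + B.[0] = 0].
  have [A [B [n [rB normE n_odd]]]] := odd_power_norm_exists g x0 k_alg.
  have n_gt0 : (0 < n)%N by case: n n_odd {normE}.
  (* The norm vanishes at [P], hence [A + B Y] or its conjugate does; they are
     exchanged if needed, so that the pole of their quotient is at [P]. *)
  have [e|e] := eqVneq (A.[0] + B.[0] * b) 0; last first.
    exists A, B, n; split=> //.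
    have := congr1 (horner^~ 0) normE; rewrite /norm_form !expr2 !(hornerD, hornerN, hornerM) hornerXn.
    rewrite -b_curve expr0n (gtn_eqF n_gt0) /= => e0.
    apply: (mulfI e); rewrite mulr0 -[RHS]e0.
    have -> : (A.[0] + B.[0] * b) * (A.[0] + B.[0] * b + B.[0]) =
      A.[0] * A.[0] + A.[0] * B.[0] - B.[0] * B.[0] * (b ^+ 2 - b)
      + 2 * (A.[0] * (B.[0] * b) + B.[0] * B.[0] * b ^+ 2) by ring.
    by rewrite two0 mul0r addr0.
  exists (A + B), B, n; split=> //; last first.
    rewrite hornerD; have -> : A.[0] + B.[0] + B.[0] * b + B.[0] =
      A.[0] + B.[0] * b + 2 * B.[0] by ring.
    by rewrite two0 mul0r addr0.
  rewrite -normE /norm_form.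
  have -> : (A + B) ^+ 2 + (A + B) * B - B ^+ 2 * c =
    A ^+ 2 + A * B - B ^+ 2 * c + 2 * (A * B + B ^+ 2) by ring.
  by rewrite (char2_eq0 (pchar2_poly char2)) mul0r addr0.
have B0 : B != 0 by apply: contraNneq rB => ->; rewrite root0.
have nE := odd_norm_degree char2 (size_c x0) B0 normE n_odd.
have sB : (0 < size B)%N by rewrite size_poly_gt0.
exists n; split=> //.
- by case: n n_odd {normE nE}.
- by rewrite nE; move: (size B) sB => s; lia.
- by rewrite pchar2'_nat // oddM n_odd andbT mul2n addn1 /= odd_double.
exists ((em A + em B * hyperell_Y k g) / (em A + em B * hyperell_Y k g + em B)).
apply: (lame_cover char2 (size_c x0) cstE em_inj Yeq gen rB normE n_odd b_curve beta'_b Pb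
  _ (point_infinityX (size_c x0) cstE em_inj Yeq gen) g_gt0).
have image z : above (hyperell_involution (pchar2_of_F2 j) P) 0 z =
    above P 0 (hyperell_conj g (pchar2_of_F2 j) z).
  by rewrite /above fmorph_eq0.
case/andP: Pb => Pt PY; rewrite /centre !image !rmorphB hyperell_conjY.
move: Pt; rewrite rmorphB -hyperell_poly_cst hyperell_polyX !rmorph0 !subr0 => Pt.
rewrite rmorphB hyperell_conjX !hyperell_conj_cst Pt andTb.
have cstD1 (C : curve k) : cst C (b + 1) = cst C b + 1 by rewrite rmorphD rmorph1.
have cancel1 (F : fieldType) (y z : F) : y - z = y + 1 - (z + 1) by ring.
rewrite cstD1; exact: (eq_ind _ (vanishes P) PY _ (cancel1 (fun_field (hyperell_curve k g)) _ _)).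
Qed.
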